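(* Cubical $\omega$-categories are the algebras for a familial monad on semicubical sets: there is a familial monad $T$ on the category $\widehat{\square_\partial}$ of semicubical sets whose category of algebras is equivalent, compatibly with the forgetful functors to $\widehat{\square_\partial}$, to the category of cubical $\omega$-categories (and maps preserving all of the structure).
   Context: The semicube category $\square_\partial$ is the free monoidal category generated by one object $\square^1$ and two maps $\partial_0,\partial_1\colon\square^0\to\square^1$, where $\square^0$ is the monoidal unit; its objects are $\square^n=(\square^1)^{\otimes n}$. A semicubical set is a presheaf on $\square_\partial$; explicitly, sets $A_n$ ($n\ge0$) with face maps $d_{i,\varepsilon}\colon A_n\to A_{n-1}$ ($1\le i\le n$, $\varepsilon\in\{0,1\}$) with $d_{i,\varepsilon}d_{j,\eta}=d_{j-1,\eta}d_{i,\varepsilon}$ for $i<j$. A cubical set is a semicubical set with degeneracies $s_i\colon A_{n-1}\to A_n$ ($1\le i\le n$) satisfying $s_is_j=s_{j+1}s_i$ for $i\le j$, and $d_{i,\varepsilon}s_j=s_{j-1}d_{i,\varepsilon}$ for $i<j$, $d_{i,\varepsilon}s_j=\mathrm{id}$ for $i=j$, $d_{i,\varepsilon}s_j=s_jd_{i-1,\varepsilon}$ for $i>j$. A cubical $\omega$-category (without connections or symmetries) is a cubical set $A$ with, for each $n\ge1$ and $1\le j\le n$, a composition $a\circ_jb\in A_n$ defined for $a,b\in A_n$ with $d_{j,1}a=d_{j,0}b$, such that: (1) $d_{j,0}(a\circ_jb)=d_{j,0}a$, $d_{j,1}(a\circ_jb)=d_{j,1}b$, and $d_{i,\varepsilon}(a\circ_jb)$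 equals $d_{i,\varepsilon}a\circ_{j-1}d_{i,\varepsilon}b$ if $i<j$ and $d_{i,\varepsilon}a\circ_jd_{i,\varepsilon}b$ if $i>j$; (2) each $\circ_j$ is associative, and unital: $s_jd_{j,0}a\circ_ja=a=a\circ_js_jd_{j,1}a$; (3) (interchange) $(a\circ_ib)\circ_j(c\circ_id)=(a\circ_jc)\circ_i(b\circ_jd)$ for $i\ne j$ whenever both sides are defined; (4) $s_i(a\circ_jb)$ equals $s_ia\circ_{j+1}s_ib$ if $i\le j$ and $s_ia\circ_js_ib$ if $i>j$. A familial monad on $\widehat{\mathcal C}=\mathbf{Set}^{\mathcal C^{op}}$ is a monad whose unit and multiplication are cartesian (all naturality squares are pullbacks) and whose functor part is familial: naturally isomorphic to $X\mapsto\big(c\mapsto\coprod_{t\in Sc}\mathrm{Hom}_{\widehat{\mathcal C}}(Et,X)\big)$ for some functors $S\colon\mathcal C^{op}\to\mathbf{Set}$ and $E\colon\int S\to\widehat{\mathcal C}$, where $\int S$ is the category of elements of $S$ (objects $(c,t)$ with $t\in Sc$; morphisms $i_t\colon Si(t)\to t$ for $i\colon c'\to c$ in $\mathcal C$) and $i\colon c'\to c$ acts by precomposition with $E(i_t)$. *)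

(* Defs.v *)
From mathcomp Require Import all_boot.
From mathcomp Require Import boolp.

Set Implicit Arguments.
Unset Strict Implicit.
Unset Printing Implicit Defensive.

Declare Scope cat_scope.
Delimit Scope cat_scope with cat.
Local Open Scope cat_scope.

Lemma sval_inj_prop (A : Type) (P : A -> Prop) (u v : {x : A | P x}) :
  sval u = sval v -> u = v.
Proof. by case: u v => [x p] [y q] /= e; apply: eq_exist. Qed.

(** * Categories *)

Record category := Category {
  ob :> Type;
  hom : ob -> ob -> Type;
  idm : forall a, hom a a;
  cmp : forall {a b c}, hom b c -> hom a b -> hom a c;
  cmp_idl : forall a b (f : hom a b), cmp (idm b) f = f;
  cmp_idr : forall a b (f : hom a b), cmp f (idm a) = f;
  cmp_assoc : forall a b c d (h : hom c d) (g : hom b c) (f : hom a b),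
    cmp (cmp h g) f = cmp h (cmp g f) }.

Notation "g ∘ f" := (cmp g f) (at level 40, left associativity) : cat_scope.

Definition is_iso (C : category) (a b : C) (f : hom a b) : Prop :=
  exists g : hom b a, g ∘ f = idm a /\ f ∘ g = idm b.

(* The square  f ∘ p = g ∘ q  is a pullback. *)
Definition is_pullback (C : category) (a b c d : C)
    (p : hom a b) (q : hom a c) (f : hom b d) (g : hom c d) : Prop :=
  f ∘ p = g ∘ q /\
  forall (x : C) (u : hom x b) (v : hom x c), f ∘ u = g ∘ v ->
    exists! w : hom x a, p ∘ w = u /\ q ∘ w = v.

Record functor (C D : category) := Functor {
  fob :> C -> D;
  fmap : forall {a b}, hom a b -> hom (fob a) (fob b);
  fmap_id : forall a, fmap (idm a) = idm (fob a);
  fmap_cmp : forall a b c (g : hom b c) (f : hom a b),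
    fmap (g ∘ f) = fmap g ∘ fmap f }.
Arguments fmap {C D} F {a b} f : rename.

Definition functor_id (C : category) : functor C C :=
  @Functor C C (fun a => a) (fun a b f => f)
    (fun a => erefl) (fun a b c g f => erefl).

Section FunctorComp.
Variables (C D E : category) (G : functor D E) (F : functor C D).

Lemma functor_comp_id a : fmap G (fmap F (idm a)) = idm (G (F a)).
Proof. by rewrite !fmap_id. Qed.

Lemma functor_comp_cmp a b c (g : hom b c) (f : hom a b) :
  fmap G (fmap F (g ∘ f)) = fmap G (fmap F g) ∘ fmap G (fmap F f).
Proof. by rewrite !fmap_cmp. Qed.

Definition functor_comp : functor C E :=
  @Functor C E (fun a => G (F a)) (fun a b f => fmap G (fmap F f))
    functor_comp_id functor_comp_cmp.
End FunctorComp.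

Record nat_trans (C D : category) (F G : functor C D) := NatTrans {
  nt :> forall a, hom (F a) (G a);
  nt_nat : forall a b (f : hom a b), nt b ∘ fmap F f = fmap G f ∘ nt a }.

Definition nat_isomorphic (C D : category) (F G : functor C D) : Prop :=
  exists alpha : nat_trans F G, forall a, is_iso (alpha a).

Definition is_equivalence (C D : category) (F : functor C D) : Prop :=
  exists G : functor D C,
    nat_isomorphic (functor_comp G F) (functor_id C) /\
    nat_isomorphic (functor_comp F G) (functor_id D).

Definition cartesian (C D : category) (F G : functor C D)
    (alpha : nat_trans F G) : Prop :=
  forall (a b : C) (f : hom a b),
    is_pullback (fmap F f) (alpha a) (alpha b) (fmap G f).

(** * Monads and their algebras *)

Record monad (C : category) := Monad {
  mfun :> functor C C;
  munit : nat_trans (functor_id C) mfun;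
  mmult : nat_trans (functor_comp mfun mfun) mfun;
  mmult_unitl : forall a, mmult a ∘ munit (mfun a) = idm (mfun a);
  mmult_unitr : forall a, mmult a ∘ fmap mfun (munit a) = idm (mfun a);
  mmult_assoc : forall a,
    mmult a ∘ mmult (mfun a) = mmult a ∘ fmap mfun (mmult a) }.

Section Algebras.
Variables (C : category) (T : monad C).

Record algebra := Algebra {
  alg_ob :> C;
  alg_str : hom (T alg_ob) alg_ob;
  alg_unit : alg_str ∘ munit T alg_ob = idm alg_ob;
  alg_mult : alg_str ∘ mmult T alg_ob = alg_str ∘ fmap T alg_str }.

Definition is_alg_hom (A B : algebra) (f : hom (alg_ob A) (alg_ob B)) : Prop :=
  f ∘ alg_str A = alg_str B ∘ fmap T f.

Definition alg_hom (A B : algebra) :=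
  {f : hom (alg_ob A) (alg_ob B) | is_alg_hom f}.

Lemma is_alg_hom_id (A : algebra) : is_alg_hom (idm (alg_ob A)).
Proof. by rewrite /is_alg_hom fmap_id cmp_idl cmp_idr. Qed.

Lemma is_alg_hom_cmp (A B D : algebra) (g : alg_hom B D) (f : alg_hom A B) :
  is_alg_hom (sval g ∘ sval f).
Proof.
case: g f => [g gP] [f fP] /=; rewrite /is_alg_hom fmap_cmp.
by rewrite cmp_assoc fP -cmp_assoc gP cmp_assoc.
Qed.

Definition alg_cat : category.
Proof.
refine (@Category algebra alg_hom (fun A => exist _ _ (is_alg_hom_id A))
  (fun A B D g f => exist _ _ (is_alg_hom_cmp g f)) _ _ _).
- by move=> A B f; apply: sval_inj_prop; apply: cmp_idl.
- by move=> A B f; apply: sval_inj_prop; apply: cmp_idr.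
- by move=> A B D E h g f; apply: sval_inj_prop; apply: cmp_assoc.
Defined.

Definition alg_forget : functor alg_cat C :=
  @Functor alg_cat C alg_ob (fun A B f => sval f)
    (fun A => erefl) (fun A B D g f => erefl).
End Algebras.

(** * Presheaves *)

(* Presheaves are taken on categories whose objects and morphisms live in
   [Set], so that the sets of maps between presheaves, and the coproducts of
   these indexed by a presheaf, stay in the universe in which presheaves take
   their values. *)
Record small_category := SmallCategory {
  sob :> Set;
  shom : sob -> sob -> Set;
  sidm : forall a, shom a a;
  scmp : forall {a b c}, shom b c -> shom a b -> shom a c;
  scmp_idl : forall a b (f : shom a b), scmp (sidm b) f = f;
  scmp_idr : forall a b (f : shom a b), scmp f (sidm a) = f;
  scmp_assoc : forall a b c d (h : shom c d) (g : shom b c) (f : shom a b),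
    scmp (scmp h g) f = scmp h (scmp g f) }.

Definition large (C : small_category) : category :=
  @Category C (@shom C) (@sidm C) (@scmp C)
    (@scmp_idl C) (@scmp_idr C) (@scmp_assoc C).

Section Presheaves.
Variable C : small_category.

Record presheaf := Presheaf {
  psh :> C -> Type;
  act : forall {a b}, shom a b -> psh b -> psh a;
  act_id : forall a (x : psh a), act (sidm a) x = x;
  act_cmp : forall a b c (g : shom b c) (f : shom a b) (x : psh c),
    act (scmp g f) x = act f (act g x) }.
Arguments act p {a b} f x.

Record psh_hom (X Y : presheaf) := PshHom {
  phm :> forall a, X a -> Y a;
  phm_nat : forall a b (f : shom a b) (x : X b),
    @phm a (act X f x) = act Y f (@phm b x) }.
Arguments phm {X Y} p a x : rename.

Lemma psh_hom_ext (X Y : presheaf) (f g : psh_hom X Y) :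
  (forall a x, f a x = g a x) -> f = g.
Proof.
case: f g => [f fP] [g gP] /= fg.
have e : f = g by apply: functional_extensionality_dep => a; apply: funext.
by case: _ / e gP {fg} => gP; congr PshHom; apply: Prop_irrelevance.
Qed.

Definition psh_id (X : presheaf) : psh_hom X X :=
  @PshHom X X (fun a x => x) (fun a b f x => erefl).

Lemma psh_cmp_nat (X Y Z : presheaf) (g : psh_hom Y Z) (f : psh_hom X Y)
    a b (i : shom a b) (x : X b) :
  g a (f a (act X i x)) = act Z i (g b (f b x)).
Proof. by rewrite !phm_nat. Qed.

Definition psh_cmp (X Y Z : presheaf) (g : psh_hom Y Z) (f : psh_hom X Y) :
    psh_hom X Z :=
  @PshHom X Z (fun a x => g a (f a x)) (psh_cmp_nat g f).

Definition Psh : category.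
Proof.
refine (@Category presheaf psh_hom psh_id psh_cmp _ _ _).
- by move=> X Y f; apply: psh_hom_ext.
- by move=> X Y f; apply: psh_hom_ext.
- by move=> X Y Z W h g f; apply: psh_hom_ext.
Defined.

(** * Familial functors and monads *)

(* A morphism  i_t : (a, S i t) -> (b, t)  is encoded as the map [i] together
   with a proof that [act S i t] is the second component of the source. *)
Definition elt_hom (S : presheaf) (u v : {a : C & S a}) :=
  {i : shom (tag u) (tag v) | act S i (tagged v) = tagged u}.

Lemma elt_cmp_subproof (S : presheaf) (u v w : {a : C & S a})
    (j : elt_hom v w) (i : elt_hom u v) :
  act S (scmp (sval j) (sval i)) (tagged w) = tagged u.
Proof. by rewrite act_cmp (svalP j) (svalP i). Qed.

Definition elements (S : presheaf) : category.
Proof.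
refine (@Category {a : C & S a} (@elt_hom S)
  (fun u => exist _ (sidm (tag u)) (act_id (tagged u)))
  (fun u v w j i => exist _ _ (elt_cmp_subproof j i)) _ _ _).
- by move=> u v f; apply: sval_inj_prop; apply: scmp_idl.
- by move=> u v f; apply: sval_inj_prop; apply: scmp_idr.
- by move=> u v w z h g f; apply: sval_inj_prop; apply: scmp_assoc.
Defined.

Definition elt (S : presheaf) (a : C) (t : S a) : elements S :=
  existT (fun b : C => S b) a t.

Definition elt_map (S : presheaf) (a b : C) (i : shom a b) (t : S b) :
    hom (elt (act S i t)) (elt t) :=
  exist (fun j : shom a b => act S j t = act S i t) i erefl.

Section FamilialFunctor.
Variables (S : presheaf) (E : functor (elements S) Psh).

Definition fam_cell (X : presheaf) (a : C) : Type :=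
  {t : S a & psh_hom (E (elt t)) X}.

Definition fam_act (X : presheaf) (a b : C) (i : shom a b)
    (x : fam_cell X b) : fam_cell X a :=
  existT (fun t : S a => psh_hom (E (elt t)) X)
    (act S i (tag x)) (psh_cmp (tagged x) (fmap E (elt_map i (tag x)))).

Lemma fam_cellE (X : presheaf) (a b : C) (i : shom a b) (t : S b)
    (f : psh_hom (E (elt t)) X) (s : S a) (e : act S i t = s) :
  existT (fun s : S a => psh_hom (E (elt s)) X)
    (act S i t) (psh_cmp f (fmap E (elt_map i t))) =
  existT _ s (psh_cmp f (fmap E (exist _ i e : hom (elt s) (elt t)))).
Proof. by case: _ / e. Qed.

Lemma fam_act_id X a (x : fam_cell X a) : fam_act (sidm a) x = x.
Proof.
case: x => [t f]; rewrite /fam_act /= (fam_cellE f (act_id t)).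
by have /= -> := fmap_id E (elt t); congr existT; apply: psh_hom_ext.
Qed.

Lemma fam_act_cmp X a b c (j : shom b c) (i : shom a b) (x : fam_cell X c) :
  fam_act (scmp j i) x = fam_act i (fam_act j x).
Proof.
case: x => [t f]; rewrite /fam_act /= (fam_cellE f (act_cmp j i t)).
congr existT; rewrite (_ : exist _ _ _ = elt_map j t ∘ elt_map i (act S j t)).
  by rewrite fmap_cmp; apply: psh_hom_ext.
exact: sval_inj_prop.
Qed.

Definition fam_psh (X : presheaf) : presheaf :=
  @Presheaf (fam_cell X) (@fam_act X) (@fam_act_id X) (@fam_act_cmp X).

Definition fam_map_cell (X Y : presheaf) (h : psh_hom X Y) (a : C)
    (x : fam_cell X a) : fam_cell Y a :=
  existT (fun t : S a => psh_hom (E (elt t)) Y) (tag x)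
    (psh_cmp h (tagged x)).

Lemma fam_map_nat X Y (h : psh_hom X Y) a b (i : shom a b) (x : fam_cell X b) :
  fam_map_cell h (fam_act i x) = fam_act i (fam_map_cell h x).
Proof. by congr existT; apply: psh_hom_ext. Qed.

Definition fam_map (X Y : presheaf) (h : psh_hom X Y) :
    psh_hom (fam_psh X) (fam_psh Y) :=
  @PshHom (fam_psh X) (fam_psh Y) (@fam_map_cell X Y h) (@fam_map_nat X Y h).

Definition familial_functor : functor Psh Psh.
Proof.
refine (@Functor Psh Psh fam_psh fam_map _ _).
- move=> X; apply: psh_hom_ext => a [t f] /=.
  by rewrite /fam_map_cell /=; congr existT; apply: psh_hom_ext.
- move=> X Y Z g h; apply: psh_hom_ext => a [t f] /=.
  by rewrite /fam_map_cell /=; congr existT; apply: psh_hom_ext.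
Defined.
End FamilialFunctor.

Definition is_familial (F : functor Psh Psh) : Prop :=
  exists (S : presheaf) (E : functor (elements S) Psh),
    nat_isomorphic F (familial_functor E).

Definition is_familial_monad (T : monad Psh) : Prop :=
  [/\ is_familial T, cartesian (munit T) & cartesian (mmult T)].
End Presheaves.
Arguments act {C} p {a b} f x.

(** * The semicube category *)

(* A morphism  □^m -> □^n  of the free monoidal category on  □^1  and
   ∂_0, ∂_1 : □^0 -> □^1  is a tensor product of  n  factors, each of them one
   of ∂_0, ∂_1 and the identity of □^1, the identity occurring  m  times.  The
   universal property is [semicube_free] below. *)
Inductive cube_hom : nat -> nat -> Set :=
| cube_nil : cube_hom 0 0
| cube_face m n (e : bool) (f : cube_hom m n) : cube_hom m n.+1
| cube_wire m n (f : cube_hom m n) : cube_hom m.+1 n.+1.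

Fixpoint cube_id (n : nat) : cube_hom n n :=
  if n is n'.+1 then cube_wire (cube_id n') else cube_nil.

Definition cube_hom_S (P : forall m n, cube_hom m n.+1 -> Type)
    (Pf : forall m n e (f : cube_hom m n), P m n (cube_face e f))
    (Pw : forall m n (f : cube_hom m n), P m.+1 n (cube_wire f))
    m n (f : cube_hom m n.+1) : P m n f :=
  match f in cube_hom m' k return
    (match k return cube_hom m' k -> Type with
     | 0 => fun _ => unit
     | n'.+1 => fun g => P m' n' g
     end f) with
  | cube_nil => tt
  | cube_face _ _ e g => Pf _ _ e g
  | cube_wire _ _ g => Pw _ _ g
  end.

Definition cube_hom_0 (P : forall m, cube_hom m 0 -> Type)
    (Pn : P 0 cube_nil) m (f : cube_hom m 0) : P m f :=
  match f in cube_hom m' k return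
    (match k return cube_hom m' k -> Type with
     | 0 => fun g => P m' g
     | _.+1 => fun _ => unit
     end f) with
  | cube_nil => Pn
  | _ => tt
  end.

Fixpoint cube_cmp m n p (g : cube_hom n p) : cube_hom m n -> cube_hom m p :=
  match g in cube_hom n p return cube_hom m n -> cube_hom m p with
  | cube_nil => fun f => f
  | cube_face _ _ e g' => fun f => cube_face e (cube_cmp g' f)
  | cube_wire n' p' g' => fun f =>
      match f in cube_hom m k return
        (match k with
         | 0 => unit
         | k'.+1 => (forall l, cube_hom l k' -> cube_hom l p') ->
                    cube_hom m p'.+1
         end) with
      | cube_nil => tt
      | cube_face _ _ e f' => fun c => cube_face e (c _ f')
      | cube_wire _ _ f' => fun c => cube_wire (c _ f')
      end (fun l => @cube_cmp l n' p' g')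
  end.

Lemma cube_cmp_idl m n (f : cube_hom m n) : cube_cmp (cube_id n) f = f.
Proof. by elim: f => //= [m' n' e f -> | m' n' f ->]. Qed.

Lemma cube_cmp_idr m n (f : cube_hom m n) : cube_cmp f (cube_id m) = f.
Proof. by elim: f => //= [m' n' e f -> | m' n' f ->]. Qed.

Lemma cube_cmp_assoc m n p q (h : cube_hom p q) (g : cube_hom n p)
    (f : cube_hom m n) :
  cube_cmp (cube_cmp h g) f = cube_cmp h (cube_cmp g f).
Proof.
elim: h m n g f => [m n g f|p' q' e h IH m n g f|p' q' h IH m n g f] //=.
  by rewrite IH.
move: h IH f; elim/cube_hom_S: g => [n' k e g h IH f|n' k g h IH f] /=.
  by rewrite IH.
move: g h IH; elim/cube_hom_S: f => [m' k' e f g h IH|m' k' f g h IH] /=.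
  by rewrite IH.
by rewrite IH.
Qed.

Definition semicube : small_category :=
  @SmallCategory nat cube_hom cube_id (fun m n p => @cube_cmp m n p)
    cube_cmp_idl cube_cmp_idr cube_cmp_assoc.

Definition cube_dd (e : bool) : cube_hom 0 1 := cube_face e cube_nil.

Fixpoint cube_tens m n p q (f : cube_hom m n) (g : cube_hom p q) :
    cube_hom (m + p) (n + q) :=
  match f in cube_hom m n return cube_hom (m + p) (n + q) with
  | cube_nil => g
  | cube_face _ _ e f' => cube_face e (cube_tens f' g)
  | cube_wire _ _ f' => cube_wire (cube_tens f' g)
  end.

(** ** Strict monoidal categories and the universal property *)

Definition hom_cast (C : category) (a b a' b' : C) (ea : a = a') (eb : b = b')
    (f : hom a b) : hom a' b' :=
  eq_rect b (hom a') (eq_rect a (fun x => hom x b) f a' ea) b' eb.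

(* Equality of morphisms up to equalities of their end points. *)
Definition heq (C : category) (a b a' b' : C) (f : hom a b) (f' : hom a' b') :
    Prop :=
  exists (ea : a = a') (eb : b = b'), hom_cast ea eb f = f'.

Record strict_monoidal := StrictMonoidal {
  smc :> category;
  sm1 : smc;
  smt : smc -> smc -> smc;
  smtm : forall {a b c d : smc},
    hom a b -> hom c d -> hom (smt a c) (smt b d);
  smtm_id : forall a b : smc, smtm (idm a) (idm b) = idm (smt a b);
  smtm_cmp : forall (a b c a' b' c' : smc) (g : hom b c) (f : hom a b)
    (g' : hom b' c') (f' : hom a' b'),
    smtm (g ∘ f) (g' ∘ f') = smtm g g' ∘ smtm f f';
  smtA : forall a b c : smc, smt a (smt b c) = smt (smt a b) c;
  smt1l : forall a : smc, smt sm1 a = a;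
  smt1r : forall a : smc, smt a sm1 = a;
  smtmA : forall (a b c a' b' c' : smc)
    (f : hom a a') (g : hom b b') (h : hom c c'),
    heq (smtm f (smtm g h)) (smtm (smtm f g) h);
  smtm1l : forall (a b : smc) (f : hom a b), heq (smtm (idm sm1) f) f;
  smtm1r : forall (a b : smc) (f : hom a b), heq (smtm f (idm sm1)) f }.
Arguments smtm {s a b c d} f g.

Definition strict_functor (M N : strict_monoidal) (F : functor M N) : Prop :=
  [/\ F (sm1 M) = sm1 N,
      forall a b : M, F (smt a b) = smt (F a) (F b)
    & forall (a b c d : M) (f : hom a b) (g : hom c d),
        heq (fmap F (smtm f g)) (smtm (fmap F f) (fmap F g))].

(* [M] is the free strict monoidal category on an object [x] and the maps
   [d e] from the unit to [x]. *)
Definition is_free_monoidal (M : strict_monoidal) (x : M)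
    (d : bool -> hom (sm1 M) x) : Prop :=
  forall (N : strict_monoidal) (y : N) (d' : bool -> hom (sm1 N) y),
    let extends (F : functor M N) :=
      [/\ strict_functor F, F x = y & forall e, heq (fmap F (d e)) (d' e)] in
    (exists F, extends F) /\
    (forall F G, extends F -> extends G ->
       (forall a, F a = G a) /\
       (forall a b (f : hom a b), heq (fmap F f) (fmap G f))).

Section Heq.
Variable C : category.

Lemma heq_refl (a b : C) (f : hom a b) : heq f f.
Proof. by exists erefl, erefl. Qed.

Lemma heq_sym (a b a' b' : C) (f : hom a b) (f' : hom a' b') :
  heq f f' -> heq f' f.
Proof. by case=> ea [eb <-]; case: _ / ea; case: _ / eb; apply: heq_refl. Qed.

Lemma heq_trans (a b a' b' a2 b2 : C)
    (f : hom a b) (f' : hom a' b') (f2 : hom a2 b2) :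
  heq f f' -> heq f' f2 -> heq f f2.
Proof. by case=> ea [eb <-]; case: _ / ea; case: _ / eb. Qed.

Lemma heq_eq (a b : C) (f g : hom a b) : heq f g -> f = g.
Proof.
case=> ea [eb <-].
by rewrite (Prop_irrelevance ea erefl) (Prop_irrelevance eb erefl).
Qed.

Lemma heq_cast (a b a' b' : C) (ea : a = a') (eb : b = b') (f : hom a b) :
  heq (hom_cast ea eb f) f.
Proof. by apply: heq_sym; exists ea, eb. Qed.

Lemma heq_idm (a b : C) : a = b -> heq (idm a) (idm b).
Proof. by move->; apply: heq_refl. Qed.

Lemma heq_cmp (a b c a' b' c' : C) (g : hom b c) (f : hom a b)
    (g' : hom b' c') (f' : hom a' b') :
  heq g g' -> heq f f' -> heq (g ∘ f) (g' ∘ f').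
Proof.
move=> + [ea [eb <-]]; case: _ / ea; move: g'; case: _ / eb => g' [eb [ec <-]].
by case: _ / ec; rewrite (Prop_irrelevance eb erefl); apply: heq_refl.
Qed.
End Heq.

Lemma heq_smtm (M : strict_monoidal) (a b c d a' b' c' d' : M)
    (f : hom a b) (g : hom c d) (f' : hom a' b') (g' : hom c' d') :
  heq f f' -> heq g g' -> heq (smtm f g) (smtm f' g').
Proof.
case=> ea [eb <-]; case: _ / ea; case: _ / eb.
case=> ec [ed <-]; case: _ / ec; case: _ / ed; exact: heq_refl.
Qed.

Lemma heq_cube_face (e : bool) (m n m' n' : large semicube)
    (f : hom m n) (f' : hom m' n') :
  heq f f' -> @heq (large semicube) _ _ _ _ (cube_face e f) (cube_face e f').
Proof. by case=> ea [eb <-]; case: _ / ea; case: _ / eb; apply: heq_refl. Qed.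

Lemma heq_cube_wire (m n m' n' : large semicube)
    (f : hom m n) (f' : hom m' n') :
  heq f f' -> @heq (large semicube) _ _ _ _ (cube_wire f) (cube_wire f').
Proof. by case=> ea [eb <-]; case: _ / ea; case: _ / eb; apply: heq_refl. Qed.

Lemma cube_tens_id m n : cube_tens (cube_id m) (cube_id n) = cube_id (m + n).
Proof. by elim: m => //= m ->. Qed.

Lemma cube_tens_cmp m n p m' n' p' (g : cube_hom n p) (f : cube_hom m n)
    (g' : cube_hom n' p') (f' : cube_hom m' n') :
  cube_tens (cube_cmp g f) (cube_cmp g' f') =
  cube_cmp (cube_tens g g') (cube_tens f f').
Proof.
elim: g m f => [m f|n1 p1 e g IH m f|n1 p1 g IH m f] /=.
- by elim/cube_hom_0: f.
- by rewrite IH.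
- move: g IH; elim/cube_hom_S: f => [m1 k e f g IH|m1 k f g IH] /=.
    by rewrite IH.
  by rewrite IH.
Qed.

Definition semicube_monoidal : strict_monoidal.
Proof.
refine (@StrictMonoidal (large semicube) 0 addn
  (fun m n p q => @cube_tens m n p q) cube_tens_id
  (fun m n p m' n' p' => @cube_tens_cmp m n p m' n' p')
  addnA add0n addn0 _ _ _).
- move=> m n p m' n' p' f g h; elim: f => /= [|k l e f IH|k l f IH].
  + exact: heq_refl.
  + exact: heq_cube_face.
  + exact: heq_cube_wire.
- by move=> m n f; apply: heq_refl.
- move=> m n f; elim: f => /= [|k l e f IH|k l f IH].
  + exact: heq_refl.
  + exact: heq_cube_face.
  + exact: heq_cube_wire.
Defined.

Section SemicubeFree.
Variables (N : strict_monoidal) (y : N) (d : bool -> hom (sm1 N) y).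

Definition spow (n : nat) : N := iter n (smt y) (sm1 N).

Fixpoint spow_map m n (f : cube_hom m n) : hom (spow m) (spow n) :=
  match f in cube_hom m n return hom (spow m) (spow n) with
  | cube_nil => idm (sm1 N)
  | cube_face m' n' e f' =>
      hom_cast (smt1l (spow m')) (erefl (spow n'.+1)) (smtm (d e) (spow_map f'))
  | cube_wire _ _ f' => smtm (idm y) (spow_map f')
  end.

Lemma heq_spow_face m n e (f : cube_hom m n) :
  heq (spow_map (cube_face e f)) (smtm (d e) (spow_map f)).
Proof. exact: heq_cast. Qed.

Lemma spow_map_id n : spow_map (cube_id n) = idm (spow n).
Proof. by elim: n => //= n ->; apply: smtm_id. Qed.

Lemma spow_map_cmp m n p (g : cube_hom n p) (f : cube_hom m n) :
  spow_map (cube_cmp g f) = spow_map g ∘ spow_map f.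
Proof.
elim: g m f => [m f|n1 p1 e g IH m f|n1 p1 g IH m f].
- by elim/cube_hom_0: f; rewrite /= cmp_idl.
- apply: heq_eq; apply: heq_trans (heq_spow_face _ _) _; rewrite IH.
  rewrite -[d e]cmp_idr smtm_cmp.
  by apply: heq_cmp; [apply/heq_sym/heq_spow_face | apply: smtm1l].
- move: g IH; elim/cube_hom_S: f => [m1 k e f g IH|m1 k f g IH] /=.
    apply: heq_eq; apply: heq_trans (heq_spow_face _ _) _; rewrite IH.
    rewrite -[d e]cmp_idl smtm_cmp cmp_idl.
    by apply: heq_cmp; [apply: heq_refl | apply/heq_sym/heq_spow_face].
  by rewrite IH -smtm_cmp cmp_idl.
Qed.

Definition spow_functor : functor semicube_monoidal N :=
  @Functor semicube_monoidal N spow spow_map spow_map_id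
    (fun m n p g f => spow_map_cmp g f).

Lemma spowD m n : spow (m + n) = smt (spow m) (spow n).
Proof. by elim: m => /= [|m ->]; rewrite ?smt1l // smtA. Qed.

Lemma spow_strict : strict_functor spow_functor.
Proof.
split=> //; first exact: spowD.
move=> m n p q f g; elim: f => [|k l e f IH|k l f IH].
- exact/heq_sym/smtm1l.
- apply: heq_trans (heq_spow_face _ _) _.
  apply: heq_trans (heq_smtm (heq_refl _) IH) _.
  apply: heq_trans (smtmA _ _ _) _.
  by apply: heq_smtm; [apply/heq_sym/heq_spow_face | apply: heq_refl].
- by apply: heq_trans (heq_smtm (heq_refl _) IH) _; apply: smtmA.
Qed.
End SemicubeFree.

Theorem semicube_free : @is_free_monoidal semicube_monoidal 1 cube_dd.
Proof.
move=> N y d; split.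
  exists (spow_functor d); split; [exact: spow_strict|exact: smt1r|move=> e].
  by apply: heq_trans (heq_spow_face _ _ _) _; apply: smtm1r.
move=> F G [[F0 FD Ft] F1 Fd] [[G0 GD Gt] G1 Gd].
have FG n : F n = G n.
  elim: n => [|n IH]; first by rewrite F0 G0.
  by rewrite (FD 1 n) (GD 1 n) F1 G1 IH.
split=> // m n f; elim: f => [|k l e f IH|k l f IH].
- rewrite (fmap_id F 0) (fmap_id G 0); exact: heq_idm.
- apply: heq_trans (Ft 0 1 k l (cube_dd e) f) _.
  apply: heq_trans (heq_sym (Gt 0 1 k l (cube_dd e) f)).
  by apply: heq_smtm IH; apply: heq_trans (Fd e) (heq_sym (Gd e)).
- apply: heq_trans (Ft 1 1 k l (cube_id 1) f) _.
  apply: heq_trans (heq_sym (Gt 1 1 k l (cube_id 1) f)).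
  apply: heq_smtm IH; rewrite (fmap_id F 1) (fmap_id G 1); exact: heq_idm.
Qed.

(** * Semicubical and cubical sets *)

(* The map  id_i ⊗ ∂_e ⊗ id_(n-i)  for i <= n; see [cofaceE]. *)
Fixpoint coface (e : bool) (n i : nat) : cube_hom n n.+1 :=
  match n with
  | 0 => cube_face e (cube_id 0)
  | n'.+1 => if i is i'.+1 then cube_wire (coface e n' i')
             else cube_face e (cube_id n'.+1)
  end.

Lemma cofaceE (e : bool) (n i : nat) : i <= n ->
  @heq (large semicube) _ _ _ _ (coface e n i)
    (cube_tens (cube_id i) (cube_tens (cube_dd e) (cube_id (n - i)))).
Proof.
elim: i n => [|i IH] [|n] //= le_in; try exact: heq_refl.
exact: heq_cube_wire (IH n le_in).
Qed.

Lemma coface_comm (e e' : bool) (n i j : nat) : i <= j -> j <= n ->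
  cube_cmp (coface e' n.+1 j.+1) (coface e n i) =
  cube_cmp (coface e n.+1 i) (coface e' n j).
Proof.
elim: n i j => [|n IH] [|i] [|j] // le_ij le_jn.
- apply: (congr1 (cube_face e) (etrans (cube_cmp_idr (coface e' n.+1 j.+1)) _)).
  exact/esym/(cube_cmp_idl (coface e' n.+1 j.+1)).
- exact: (congr1 (@cube_wire n n.+2) (IH i j le_ij le_jn)).
Qed.

Notation semicubical_set := (presheaf semicube).

(* Directions are numbered from 0: [face A e i] is  d_{i+1,e}, and [false] and
   [true] stand for the end points 0 and 1. *)
Definition face (A : semicubical_set) (n : nat) (e : bool) (i : 'I_n.+1) :
    A n.+1 -> A n :=
  act A (coface e n i).
Arguments face A {n} e i x.

Lemma face_face (A : semicubical_set) n (e e' : bool) (i j' : 'I_n.+1)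
    (i' j : 'I_n.+2) (x : A n.+2) :
  i = i' :> nat -> j = j'.+1 :> nat -> i < j ->
  face A e i (face A e' j x) = face A e' j' (face A e i' x).
Proof.
move=> ei ej lt_ij; rewrite /face -!(@act_cmp _ A n n.+1 n.+2) /= -ei ej.
by rewrite coface_comm //; [rewrite ej ltnS in lt_ij | rewrite -ltnS].
Qed.

(* In the laws below, indices shifted by one are given as further ordinals
   constrained by their values. *)
Record cubical_set := CubicalSet {
  cset :> semicubical_set;
  degen : forall n (i : 'I_n.+1), cset n -> cset n.+1;
  degen_degen : forall n (i j : 'I_n.+1) (i' j' : 'I_n.+2) (x : cset n),
    i <= j -> i' = i :> nat -> j' = j.+1 :> nat ->
    degen i' (degen j x) = degen j' (degen i x);
  face_degen_lt : forall n e (i j : 'I_n.+2) (i' j' : 'I_n.+1) (x : cset n.+1),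
    i < j -> i' = i :> nat -> j = j'.+1 :> nat ->
    face cset e i (degen j x) = degen j' (face cset e i' x);
  face_degen_eq : forall n e (i : 'I_n.+1) (x : cset n),
    face cset e i (degen i x) = x;
  face_degen_gt : forall n e (i j : 'I_n.+2) (i' j' : 'I_n.+1) (x : cset n.+1),
    j < i -> i = i'.+1 :> nat -> j' = j :> nat ->
    face cset e i (degen j x) = degen j' (face cset e i' x) }.
Arguments degen A {n} i x : rename.

(** * Cubical omega-categories *)

(* The composite [ccmp a b H] is defined only when [H] shows that the faces of
   [a] and [b] match.  A law between composites is required for all proofs
   that these are defined; in each case but interchange, the matching
   conditions on one side imply those on the other. *)
Record cubical_omega_category := CubicalOmegaCategory {
  cocset :> cubical_set;
  ccmp : forall n (j : 'I_n.+1) (a b : cocset n.+1),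
    face cocset true j a = face cocset false j b -> cocset n.+1;
  face_ccmp_src : forall n (j : 'I_n.+1) (a b : cocset n.+1) H,
    face cocset false j (@ccmp n j a b H) = face cocset false j a;
  face_ccmp_tgt : forall n (j : 'I_n.+1) (a b : cocset n.+1) H,
    face cocset true j (@ccmp n j a b H) = face cocset true j b;
  face_ccmp_lt : forall n e (i j : 'I_n.+2) (j' : 'I_n.+1)
      (a b : cocset n.+2) H H',
    i < j -> j = j'.+1 :> nat ->
    face cocset e i (@ccmp n.+1 j a b H) =
    @ccmp n j' (face cocset e i a) (face cocset e i b) H';
  face_ccmp_gt : forall n e (i j : 'I_n.+2) (j' : 'I_n.+1)
      (a b : cocset n.+2) H H',
    j < i -> j' = j :> nat ->
    face cocset e i (@ccmp n.+1 j a b H) =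
    @ccmp n j' (face cocset e i a) (face cocset e i b) H';
  ccmp_assoc : forall n (j : 'I_n.+1) (a b c : cocset n.+1) H1 H2 H3 H4,
    @ccmp n j (@ccmp n j a b H1) c H2 = @ccmp n j a (@ccmp n j b c H3) H4;
  ccmp_unitl : forall n (j : 'I_n.+1) (a : cocset n.+1) H,
    @ccmp n j (degen cocset j (face cocset false j a)) a H = a;
  ccmp_unitr : forall n (j : 'I_n.+1) (a : cocset n.+1) H,
    @ccmp n j a (degen cocset j (face cocset true j a)) H = a;
  ccmp_interchange : forall n (i j : 'I_n.+1) (a b c d : cocset n.+1)
      H1 H2 H3 H4 H5 H6,
    i != j ->
    @ccmp n j (@ccmp n i a b H1) (@ccmp n i c d H2) H3 =
    @ccmp n i (@ccmp n j a c H4) (@ccmp n j b d H5) H6;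
  degen_ccmp_le : forall n (j : 'I_n.+1) (i j' : 'I_n.+2)
      (a b : cocset n.+1) H H',
    i <= j -> j' = j.+1 :> nat ->
    degen cocset i (@ccmp n j a b H) =
    @ccmp n.+1 j' (degen cocset i a) (degen cocset i b) H';
  degen_ccmp_gt : forall n (j : 'I_n.+1) (i j' : 'I_n.+2)
      (a b : cocset n.+1) H H',
    j < i -> j' = j :> nat ->
    degen cocset i (@ccmp n j a b H) =
    @ccmp n.+1 j' (degen cocset i a) (degen cocset i b) H' }.
Arguments ccmp A {n} j a b H : rename.

Definition is_omega_map (A B : cubical_omega_category) (f : psh_hom A B) : Prop :=
  (forall n (i : 'I_n.+1) (x : A n),
     f n.+1 (degen A i x) = degen B i (f n x)) /\
  (forall n (j : 'I_n.+1) (a b : A n.+1) H H',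
     f n.+1 (ccmp A j a b H) = ccmp B j (f n.+1 a) (f n.+1 b) H').

Definition omega_map (A B : cubical_omega_category) :=
  {f : psh_hom A B | is_omega_map f}.

Lemma is_omega_map_id (A : cubical_omega_category) :
  is_omega_map (psh_id A).
Proof.
split=> // n j a b H H'.
by rewrite (Prop_irrelevance H H').
Qed.

Lemma is_omega_map_cmp (A B D : cubical_omega_category)
    (g : omega_map B D) (f : omega_map A B) :
  is_omega_map (psh_cmp (sval g) (sval f)).
Proof.
case: g f => [g [gs gc]] [f [fs fc]]; split=> [n i x|n j a b H H'] /=.
  by rewrite fs gs.
have H1 : face B true j (f n.+1 a) = face B false j (f n.+1 b).
  by rewrite /face -!(@phm_nat semicube A B f n n.+1) [act A _ _]H.
by rewrite (fc _ _ _ _ H H1); apply: gc.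
Qed.

Definition omega_cat : category.
Proof.
refine (@Category cubical_omega_category omega_map
  (fun A => exist _ _ (is_omega_map_id A))
  (fun A B D g f => exist _ _ (is_omega_map_cmp g f)) _ _ _).
- by move=> A B f; apply: sval_inj_prop; apply: psh_hom_ext.
- by move=> A B f; apply: sval_inj_prop; apply: psh_hom_ext.
- by move=> A B D E h g f; apply: sval_inj_prop; apply: psh_hom_ext.
Defined.

Definition omega_forget : functor omega_cat (Psh semicube) :=
  @Functor omega_cat (Psh semicube) (fun A => cset (cocset A))
    (fun A B f => sval f) (fun A => erefl) (fun A B D g f => erefl).

(* Main.v *)
From mathcomp Require Import all_boot.
From mathcomp Require Import boolp.
Require Import Defs.

(** The free cubical omega-category on a semicubical set X has a simple normal
    form. By interchange, every composite of cells of X of dimension n can be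
    rearranged, in exactly one way, as the composite of a rectangular grid of
    size k_1 x ... x k_n; a length k_i = 0 means that the composite is
    degenerate in direction i. So the monad T should send X to the coproduct,
    over all sequences of lengths, of the maps to X from the tensor product of
    the paths with k_1, ..., k_n edges, and this is visibly familial.

    Grids are built here one direction at a time. The paths in the first
    direction of X form a semicubical set [paths X], and a grid of dimension
    n+1 in X is a grid of dimension n in [paths X]. The ends, the constant
    paths and the concatenation of paths are natural in X; an operation on
    grids in the first direction is the action of grids on one of these
    natural maps, while an operation in direction j+1 is the operation in
    direction j on grids of paths. A law that involves the first direction
    therefore amounts either to a law of concatenation of lists or to the
    naturality of the operations in the other directions, and the remaining
    laws follow by induction. Since grids preserve pullbacks
    ([grid_map_pullback]), composable tuples of grids can be treated as grids
    of composable tuples. This gives [grid_omega].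

    For an omega-category A, composing paths in the first direction is a map
    from [paths A] to the shifted omega-category [omega_shift A]. Iterating it
    composes all the cells of a grid ([eval]). Evaluation is natural in A
    ([eval_map]), is a map of omega-categories ([eval_omega]), and is the only
    one that extends the identity ([omega_map_eval]). So grids are free
    omega-categories, and T is the monad of an adjunction whose algebras are
    compared with omega-categories: in an algebra, the operations are those of
    grids followed by the structure map, and all laws are inherited from grids
    ([alg_omega]).

    The unit is cartesian because a grid has all its lengths equal to 1 as
    soon as its image does. The multiplication is cartesian because a map of
    grids preserves lengths, so that a way to cut the image of a grid into
    smaller grids comes from a unique way to cut the grid itself
    ([eval_pullback]). Finally, T is familial because each sequence of lengths
    admits a generic grid ([grid_generic]), from which all the others with
    these lengths arise by a unique map ([familial_of_generics]). *)

Set Implicit Arguments.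
Unset Strict Implicit.
Unset Printing Implicit Defensive.
Local Open Scope cat_scope.

(** * Semicubical sets and their shift *)

Lemma coface0 e n : coface e n 0 = cube_face e (cube_id n).
Proof. by case: n. Qed.

Lemma cube_face_cmpl e m n (f : cube_hom m n) :
  cube_face e f = cube_cmp (coface e n 0) f.
Proof. by rewrite coface0 /= cube_cmp_idl. Qed.

Lemma cube_face_cmpr e m n (f : cube_hom m n) :
  cube_face e f = cube_cmp (cube_wire f) (coface e m 0).
Proof. by rewrite coface0 /= cube_cmp_idr. Qed.

(** Every map of the semicube category is a composite of cofaces, so a property
    stable under composition need only be checked on these: this is how
    compatibility with faces becomes compatibility with all maps. *)
Lemma semicube_ind (P : forall m n, cube_hom m n -> Prop) :
    (forall n, P n n (cube_id n)) ->
    (forall m n p (g : cube_hom n p) (f : cube_hom m n),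
       P n p g -> P m n f -> P m p (cube_cmp g f)) ->
    (forall e n i, i <= n -> P n n.+1 (coface e n i)) ->
  forall m n (f : cube_hom m n), P m n f.
Proof.
move=> P1 PM Pd m n f; elim: f P P1 PM Pd =>
  [|{}m {}n e f IH|{}m {}n f IH] P P1 PM Pd.
- exact: (P1 0).
- by rewrite cube_face_cmpl; apply: PM (IH _ P1 PM Pd); apply: Pd.
- apply: (IH (fun m n f => P m.+1 n.+1 (cube_wire f))) => [k|k l p g h|e k i le_ik].
  + exact: (P1 k.+1).
  + exact: PM.
  + exact: (Pd e k.+1 i.+1).
Qed.

Lemma hom_act (X Y : semicubical_set) (h : psh_hom X Y) m n (f : cube_hom m n) x :
  h m (act X f x) = act Y f (h n x).
Proof. exact: (@phm_nat semicube X Y h m n f x). Qed.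

Lemma act_cube_cmp (X : semicubical_set) m n p (g : cube_hom n p)
    (f : cube_hom m n) x :
  act X (cube_cmp g f) x = act X f (act X g x).
Proof. exact: (@act_cmp semicube X m n p g f x). Qed.

Lemma hom_face (X Y : semicubical_set) (h : psh_hom X Y) n e (i : 'I_n.+1) x :
  h n (face X e i x) = face Y e i (h n.+1 x).
Proof. exact: hom_act. Qed.

Lemma act_cube_face (X : semicubical_set) m n e (f : cube_hom m n) x :
  act X (cube_face e f) x = act X f (face X e ord0 x).
Proof. by rewrite cube_face_cmpl act_cube_cmp. Qed.

Lemma face0_wire (X : semicubical_set) m n e (f : cube_hom m n) x :
  face X e ord0 (act X (cube_wire f) x) = act X f (face X e ord0 x).
Proof.
by rewrite -act_cube_face (cube_face_cmpr e f) act_cube_cmp.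
Qed.

Section Shift.
Variable X : semicubical_set.

Lemma shift_id n (x : X n.+1) : act X (cube_wire (cube_id n)) x = x.
Proof. exact: (@act_id semicube X n.+1 x). Qed.

Lemma shift_cmp m n p (g : cube_hom n p) (f : cube_hom m n) (x : X p.+1) :
  act X (cube_wire (cube_cmp g f)) x =
  act X (cube_wire f) (act X (cube_wire g) x).
Proof. exact: (act_cube_cmp (cube_wire g) (cube_wire f)). Qed.

(** The first direction is forgotten: the cells of [shift X] in dimension n are
    those of X in dimension n+1, acted on through the other directions. The
    faces in the forgotten direction survive as the two maps [face0]. *)
Definition shift : semicubical_set :=
  @Presheaf semicube (fun n => X n.+1) (fun m n f => act X (cube_wire f))
    shift_id shift_cmp.
End Shift.

Definition shift_map (X Y : semicubical_set) (h : psh_hom X Y) :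
    psh_hom (shift X) (shift Y) :=
  @PshHom semicube (shift X) (shift Y) (fun n => h n.+1)
    (fun m n f => @hom_act X Y h m.+1 n.+1 (cube_wire f)).

Definition face0 (X : semicubical_set) (e : bool) : psh_hom (shift X) X :=
  @PshHom semicube (shift X) X (fun n => face X e ord0)
    (fun m n f x => face0_wire e f x).

(** * Pullbacks of semicubical sets, cell by cell *)

(** Squares are compared cell by cell rather than by their universal property,
    because [paths] and [grid_map] act on cells; see [cells_pullbackP]. *)
Definition cells_pullback (W X Y Z : semicubical_set) (p : psh_hom W X)
    (q : psh_hom W Y) (f : psh_hom X Z) (g : psh_hom Y Z) : Prop :=
  (forall n w, f n (p n w) = g n (q n w)) /\
  (forall n x y, f n x = g n y -> exists! w, p n w = x /\ q n w = y).

Lemma cells_pullback_inj W X Y Z (p : psh_hom W X) (q : psh_hom W Y)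
    (f : psh_hom X Z) (g : psh_hom Y Z) n (w w' : W n) :
  cells_pullback p q f g -> p n w = p n w' -> q n w = q n w' -> w = w'.
Proof.
case=> pq U e1 e2; have [w0 [_ w0P]] := U n (p n w) (q n w) (pq n w).
by rewrite -(w0P w) // -(w0P w').
Qed.

Section PullbackObject.
Variables (X Y Z : semicubical_set) (f : psh_hom X Z) (g : psh_hom Y Z).

Definition pbk_cell n := {w : X n * Y n | f n w.1 = g n w.2}.

Lemma pbk_act_subproof m n (c : cube_hom m n) (w : pbk_cell n) :
  f m (act X c (sval w).1) = g m (act Y c (sval w).2).
Proof. by rewrite !hom_act (svalP w). Qed.

Definition pbk_act m n (c : cube_hom m n) (w : pbk_cell n) : pbk_cell m :=
  exist _ (act X c (sval w).1, act Y c (sval w).2) (pbk_act_subproof c w).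

Lemma pbk_act_id n (w : pbk_cell n) : pbk_act (cube_id n) w = w.
Proof.
case: w => [[x y] fg]; apply: sval_inj_prop => /=.
by rewrite (@act_id _ X n x) (@act_id _ Y n y).
Qed.

Lemma pbk_act_cmp m n p (d : cube_hom n p) (c : cube_hom m n) (w : pbk_cell p) :
  pbk_act (cube_cmp d c) w = pbk_act c (pbk_act d w).
Proof. by apply: sval_inj_prop; rewrite /= !act_cube_cmp. Qed.

Definition pbk : semicubical_set :=
  @Presheaf semicube pbk_cell pbk_act pbk_act_id pbk_act_cmp.

Definition pbk1 : psh_hom pbk X :=
  @PshHom semicube pbk X (fun n w => (sval w).1) (fun m n c w => erefl).

Definition pbk2 : psh_hom pbk Y :=
  @PshHom semicube pbk Y (fun n w => (sval w).2) (fun m n c w => erefl).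

Lemma pbkE n w : f n (pbk1 n w) = g n (pbk2 n w).
Proof. exact: svalP w. Qed.

Lemma pbk_inj n (w w' : pbk n) :
  pbk1 n w = pbk1 n w' -> pbk2 n w = pbk2 n w' -> w = w'.
Proof.
case: w w' => [[x y] fg] [[x' y'] fg'] /= ex ey.
by apply: sval_inj_prop; rewrite /= ex ey.
Qed.

Lemma pbk_cells_pullback : cells_pullback pbk1 pbk2 f g.
Proof.
split=> [n w|n x y fg]; first exact: pbkE.
exists (exist _ (x, y) fg); split=> // w [wx wy].
by apply: pbk_inj; rewrite ?wx ?wy.
Qed.

Section Pair.
Variables (W : semicubical_set) (u : psh_hom W X) (v : psh_hom W Y).
Hypothesis uv : forall n w, f n (u n w) = g n (v n w).

Definition pbk_pair_cell n (w : W n) : pbk n := exist _ (u n w, v n w) (uv w).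

Lemma pbk_pair_nat m n (c : cube_hom m n) w :
  pbk_pair_cell (act W c w) = act pbk c (pbk_pair_cell w).
Proof. by apply: pbk_inj; rewrite /= hom_act. Qed.

Definition pbk_pair : psh_hom W pbk :=
  @PshHom semicube W pbk pbk_pair_cell pbk_pair_nat.
End Pair.
End PullbackObject.
Arguments pbk1 {X Y Z f g}.
Arguments pbk2 {X Y Z f g}.
Arguments pbkE {X Y Z f g n} w.

(** * Paths in the first direction *)

Section Chains.
Variable X : semicubical_set.

(** A path is kept as a start and a list of edges, so that concatenation is
    append, and its associativity and unit laws hold on the nose. *)
Fixpoint chain n (x : X n) (s : seq (X n.+1)) : Prop :=
  if s is e :: s' then
    face X false ord0 e = x /\ chain (face X true ord0 e) s'
  else True.

Definition chain_end n (b : bool) (x : X n) (s : seq (X n.+1)) : X n :=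
  if b then last x (map (face X true ord0) s) else x.

Lemma chain_cat n (x : X n) s t :
  chain x (s ++ t) <-> chain x s /\ chain (chain_end true x s) t.
Proof.
elim: s x => /= [|e s IH] x; first by split=> [|[]].
by rewrite IH; split=> [[? []]|[[]]].
Qed.

Lemma chain_end_cat n (x : X n) s t :
  chain_end true x (s ++ t) = chain_end true (chain_end true x s) t.
Proof. by rewrite /chain_end map_cat last_cat. Qed.
End Chains.

Section ChainMap.
Variables (X Y : semicubical_set) (m n : nat).
Variables (h : X n -> Y m) (h1 : X n.+1 -> Y m.+1).
Hypothesis hE : forall e x, face Y e ord0 (h1 x) = h (face X e ord0 x).

Lemma chain_map x s : chain x s -> chain (h x) (map h1 s).
Proof. by elim: s x => //= e s IH x [<- /IH ?]; rewrite !hE. Qed.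

Lemma chain_end_map b x s :
  chain_end b (h x) (map h1 s) = h (chain_end b x s).
Proof.
by case: b => //; rewrite /chain_end; elim: s x => //= e s IH x; rewrite hE IH.
Qed.
End ChainMap.

Section Paths.
Variable X : semicubical_set.

Definition path_cell n := {p : X n * seq (X n.+1) | chain p.1 p.2}.

Definition path_act m n (f : cube_hom m n) (p : path_cell n) : path_cell m :=
  exist _ (act X f (sval p).1, map (act X (cube_wire f)) (sval p).2)
    (chain_map (fun e x => face0_wire e f x) (svalP p)).

Lemma path_act_id n (p : path_cell n) : path_act (cube_id n) p = p.
Proof.
case: p => [[x s] c]; apply: sval_inj_prop => /=; congr pair.
  exact: (@act_id _ X n x).
by rewrite -[RHS]map_id; apply: eq_map => y; apply: (@act_id _ X n.+1 y).
Qed.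

Lemma path_act_cmp m n p (g : cube_hom n p) (f : cube_hom m n) (x : path_cell p) :
  path_act (cube_cmp g f) x = path_act f (path_act g x).
Proof.
apply: sval_inj_prop; rewrite /= act_cube_cmp -map_comp; congr pair.
by apply: eq_map => y; apply: shift_cmp.
Qed.

(** In dimension n, the coproduct over k of the sets of maps to X from the
    tensor product of P_k with the n-cube, where P_k is the path with k edges.
    With [path_end], [path_refl] and [path_cat] it is a category internal to
    endofunctors of semicubical sets, which is the structure that an
    omega-category has in one direction. *)
Definition paths : semicubical_set :=
  @Presheaf semicube path_cell path_act path_act_id path_act_cmp.

Lemma path_end_nat b m n (f : cube_hom m n) (p : paths n) :
  chain_end b (sval (act paths f p)).1 (sval (act paths f p)).2 =
  act X f (chain_end b (sval p).1 (sval p).2).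
Proof. exact: (chain_end_map (fun e x => face0_wire e f x)). Qed.

Definition path_end b : psh_hom paths X :=
  @PshHom semicube paths X (fun n p => chain_end b (sval p).1 (sval p).2)
    (path_end_nat b).

Definition path_refl_cell n (x : X n) : paths n :=
  exist (fun p : X n * seq (X n.+1) => chain p.1 p.2) (x, [::]) I.

Lemma path_refl_nat m n (f : cube_hom m n) x :
  path_refl_cell (act X f x) = act paths f (path_refl_cell x).
Proof. exact: sval_inj_prop. Qed.

Definition path_refl : psh_hom X paths :=
  @PshHom semicube X paths path_refl_cell path_refl_nat.

Definition path_edge_cell n (x : X n.+1) : paths n :=
  exist (fun p : X n * seq (X n.+1) => chain p.1 p.2)
    (face X false ord0 x, [:: x]) (conj erefl I).

Lemma path_edge_nat m n (f : cube_hom m n) (x : shift X n) :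
  path_edge_cell (act (shift X) f x) = act paths f (path_edge_cell x).
Proof. by apply: sval_inj_prop; rewrite /= face0_wire. Qed.

Definition path_edge : psh_hom (shift X) paths :=
  @PshHom semicube (shift X) paths path_edge_cell path_edge_nat.

Definition paths2 := pbk (path_end true) (path_end false).

Lemma path_cat_subproof n (w : paths2 n) :
  chain (sval (pbk1 n w)).1 ((sval (pbk1 n w)).2 ++ (sval (pbk2 n w)).2).
Proof.
apply/chain_cat; split; first exact: svalP (pbk1 n w).
by have := pbkE w; rewrite /= /chain_end => ->; apply: svalP (pbk2 n w).
Qed.

Definition path_cat_cell n (w : paths2 n) : paths n :=
  exist (fun p : X n * seq (X n.+1) => chain p.1 p.2)
    ((sval (pbk1 n w)).1, (sval (pbk1 n w)).2 ++ (sval (pbk2 n w)).2)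
    (path_cat_subproof w).

Lemma path_cat_nat m n (f : cube_hom m n) (w : paths2 n) :
  path_cat_cell (act paths2 f w) = act paths f (path_cat_cell w).
Proof. by apply: sval_inj_prop; rewrite /= map_cat. Qed.

Definition path_cat : psh_hom paths2 paths :=
  @PshHom semicube paths2 paths path_cat_cell path_cat_nat.

Lemma path_end_refl b n (x : X n) : path_end b n (path_refl n x) = x.
Proof. by case: b. Qed.

Lemma path_end_edge b n (x : shift X n) :
  path_end b n (path_edge n x) = face0 X b n x.
Proof. by case: b. Qed.

Lemma path_end_cat b n (w : paths2 n) :
  path_end b n (path_cat n w) =
  if b then path_end true n (pbk2 n w) else path_end false n (pbk1 n w).
Proof.
case: b => //; rewrite /= -/(chain_end true _ _) chain_end_cat.
by have := pbkE w; rewrite /= => ->.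
Qed.
End Paths.

Section PathMap.
Variables (X Y : semicubical_set) (h : psh_hom X Y).

Definition path_map_cell n (p : paths X n) : paths Y n :=
  exist _ (h n (sval p).1, map (h n.+1) (sval p).2)
    (chain_map (fun e x => esym (hom_face h e ord0 x)) (svalP p)).

Lemma path_map_nat m n (f : cube_hom m n) (p : paths X n) :
  path_map_cell (act (paths X) f p) = act (paths Y) f (path_map_cell p).
Proof.
apply: sval_inj_prop; rewrite /= hom_act -!map_comp; congr pair.
by apply: eq_map => x; apply: (hom_act h (cube_wire f)).
Qed.

Definition path_map : psh_hom (paths X) (paths Y) :=
  @PshHom semicube (paths X) (paths Y) path_map_cell path_map_nat.

Lemma path_end_map b n (p : paths X n) :
  path_end Y b n (path_map n p) = h n (path_end X b n p).
Proof. exact: (chain_end_map (fun e x => esym (hom_face h e ord0 x))). Qed.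

Definition path_map2 : psh_hom (paths2 X) (paths2 Y).
Proof.
refine (@pbk_pair _ _ _ _ _ _ (psh_cmp path_map pbk1) (psh_cmp path_map pbk2) _).
by move=> n w; rewrite [LHS]path_end_map [RHS]path_end_map; congr (h n _);
  apply: pbkE.
Defined.

Lemma path_map_refl n x :
  path_map n (path_refl X n x) = path_refl Y n (h n x).
Proof. exact: sval_inj_prop. Qed.

Lemma path_map_edge n (x : X n.+1) :
  path_map n (path_edge X n x) = path_edge Y n (h n.+1 x).
Proof. by apply: sval_inj_prop; rewrite /= (hom_face h). Qed.

Lemma path_map_cat n w :
  path_map n (path_cat X n w) = path_cat Y n (path_map2 n w).
Proof. by apply: sval_inj_prop; rewrite /= map_cat. Qed.
End PathMap.

Lemma path_map_id X : path_map (psh_id X) = psh_id (paths X).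
Proof.
by apply: psh_hom_ext => n [[x s] c]; apply: sval_inj_prop; rewrite /= map_id.
Qed.

Lemma path_map_cmp X Y Z (g : psh_hom Y Z) (f : psh_hom X Y) :
  path_map (psh_cmp g f) = psh_cmp (path_map g) (path_map f).
Proof.
by apply: psh_hom_ext => n p; apply: sval_inj_prop; rewrite /= map_comp.
Qed.

Lemma paths_ext X n (p q : paths X n) :
  (sval p).1 = (sval q).1 -> (sval p).2 = (sval q).2 -> p = q.
Proof.
by case: p q => [[x s] c] [[y t] d] /= ex es; apply: sval_inj_prop; congr pair.
Qed.

(** Paths of length k are a limit of cells and limits commute; on lists, the two
    given paths have equal length and are zipped. *)
Lemma path_map_pullback W X Y Z (p : psh_hom W X) (q : psh_hom W Y)
    (f : psh_hom X Z) (g : psh_hom Y Z) :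
  cells_pullback p q f g ->
  cells_pullback (path_map p) (path_map q) (path_map f) (path_map g).
Proof.
move=> [pq U]; split=> [n w|n a b ab].
  apply: paths_ext => /=; first exact: pq.
  by rewrite -!map_comp; apply: eq_map => x; apply: pq.
have inj m w w' := @cells_pullback_inj _ _ _ _ _ _ _ _ m w w' (conj pq U).
case: a b ab => [[x s] cs] [[y t] ct] [exy est].
have [w0 [[w0x w0y] _]] := U n x y exy.
have [r [cr rs rt]] : exists r, [/\ chain w0 r, map (p n.+1) r = s
                                  & map (q n.+1) r = t].
  move: cs ct; rewrite /=.
  elim: s x y t est w0 w0x w0y {exy} => [|u s IH] x y [|v t] //=.
    by move=> _ w0 _ _; exists [::].
  move=> [uv /IH{}IH] w0 w0x w0y [us cs] [vt ct].
  have [w [[wu wv] _]] := U n.+1 u v uv.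
  have [|| r [cr rs rt]] := IH _ _ (face W true ord0 w) _ _ cs ct.
  - by rewrite (hom_face p) wu.
  - by rewrite (hom_face q) wv.
  exists (w :: r); rewrite /= rs rt wu wv; split=> //; split=> //.
  by apply: inj; rewrite !(hom_face p, hom_face q) ?wu ?wv ?us ?vt.
exists (exist (fun p : W n * seq (W n.+1) => chain p.1 p.2) (w0, r) cr); split.
  by split; apply: paths_ext.
move=> [[w0' r'] c'] [[e1 e2] [e3 e4]]; apply: paths_ext => /=.
  by apply: inj; rewrite ?w0x ?w0y.
elim: r r' s t rs rt e2 e4 {cr cs ct est c'} => [|u r IH] [|u' r'] [|a s] [|b t] //=.
move=> [ua us] [ub ut] [ua' us'] [ub' ut']; congr cons.
  by apply: inj; rewrite ?ua ?ub.
by apply: (IH r' s t).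
Qed.

(** * Grids *)

(** Each step of the recursion chooses the length of the grid in one direction.
    The first direction of a grid is the innermost [paths], so it is the one
    handled by [grid_map], while the others are those of a grid of paths. *)
Fixpoint grid n (X : semicubical_set) : Type :=
  if n is n'.+1 then grid n' (paths X) else X 0.

Fixpoint grid_map n : forall X Y, psh_hom X Y -> grid n X -> grid n Y :=
  match n with
  | 0 => fun X Y h => h 0
  | n'.+1 => fun X Y h => @grid_map n' _ _ (path_map h)
  end.
Arguments grid_map n {X Y} h t.

Lemma grid_map_id n X (t : grid n X) : grid_map n (psh_id X) t = t.
Proof. by elim: n X t => //= n IH X t; rewrite path_map_id IH. Qed.

Lemma grid_map_cmp n X Y Z (g : psh_hom Y Z) (f : psh_hom X Y) (t : grid n X) :
  grid_map n (psh_cmp g f) t = grid_map n g (grid_map n f t).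
Proof. by elim: n X Y Z g f t => //= n IH X Y Z g f t; rewrite path_map_cmp IH. Qed.

Lemma grid_map_ext n X Y (f g : psh_hom X Y) (t : grid n X) :
  (forall m x, f m x = g m x) -> grid_map n f t = grid_map n g t.
Proof. by move=> /psh_hom_ext ->. Qed.

Lemma grid_map_square n X Y Y' Z (f : psh_hom X Y) (g : psh_hom Y Z)
    (f' : psh_hom X Y') (g' : psh_hom Y' Z) (t : grid n X) :
  (forall m x, g m (f m x) = g' m (f' m x)) ->
  grid_map n g (grid_map n f t) = grid_map n g' (grid_map n f' t).
Proof. by move=> e; rewrite -!grid_map_cmp; apply: grid_map_ext. Qed.

Lemma grid_map_triangle n X Y Z (f : psh_hom X Y) (g : psh_hom Y Z)
    (h : psh_hom X Z) (t : grid n X) :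
  (forall m x, g m (f m x) = h m x) ->
  grid_map n g (grid_map n f t) = grid_map n h t.
Proof. by move=> e; rewrite -grid_map_cmp; apply: grid_map_ext. Qed.

(** Grids of a limit are limits of grids. A tuple of grids with matching faces
    can thus be regarded as one grid in a semicubical set of tuples, which is
    how every law in the first direction is reduced to a law about paths. *)
Lemma grid_map_pullback n W X Y Z (p : psh_hom W X) (q : psh_hom W Y)
    (f : psh_hom X Z) (g : psh_hom Y Z) :
  cells_pullback p q f g ->
  forall x y, grid_map n f x = grid_map n g y ->
  exists! w, grid_map n p w = x /\ grid_map n q w = y.
Proof.
elim: n W X Y Z p q f g => [|n IH] W X Y Z p q f g pb; first exact: (pb.2 0).
exact: IH (path_map_pullback pb).
Qed.

Lemma grid_map_inj n W X Y Z (p : psh_hom W X) (q : psh_hom W Y)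
    (f : psh_hom X Z) (g : psh_hom Y Z) (w w' : grid n W) :
  cells_pullback p q f g ->
  grid_map n p w = grid_map n p w' -> grid_map n q w = grid_map n q w' -> w = w'.
Proof.
move=> pb e1 e2.
have e : grid_map n f (grid_map n p w) = grid_map n g (grid_map n q w).
  by apply: grid_map_square; case: pb.
have [w0 [_ w0P]] := grid_map_pullback pb e.
by rewrite -(w0P w) // -(w0P w').
Qed.

Fixpoint grid_act m n (c : cube_hom m n) : forall X, grid n X -> grid m X :=
  match c in cube_hom m n return forall X, grid n X -> grid m X with
  | cube_nil => fun X t => t
  | cube_face m n e c' => fun X t => grid_act c' (grid_map n (path_end X e) t)
  | cube_wire m n c' => fun X t => @grid_act m n c' (paths X) t
  end.

Lemma grid_map_act m n (c : cube_hom m n) X Y (h : psh_hom X Y) (t : grid n X) :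
  grid_map m h (grid_act c t) = grid_act c (grid_map n h t).
Proof.
elim: c X Y h t => //= {}m {}n e c IH X Y h t; rewrite IH; congr grid_act.
by apply: grid_map_square => k x; rewrite path_end_map.
Qed.

Lemma grid_act_id n X (t : grid n X) : grid_act (cube_id n) t = t.
Proof. by elim: n X t => //= n IH X t; apply: IH. Qed.

Lemma grid_act_cmp m n p (d : cube_hom n p) (c : cube_hom m n) X (t : grid p X) :
  grid_act (cube_cmp d c) t = grid_act c (grid_act d t).
Proof.
elim: d m c X t => [|n' p' e d IH|n' p' d IH] m c X t //=.
move: d IH t; elim/cube_hom_S: c => [m' k e c d IH t|m' k c d IH t] /=.
  by rewrite IH grid_map_act.
exact: IH.
Qed.

Definition grids (X : semicubical_set) : semicubical_set :=
  @Presheaf semicube (fun n => grid n X) (fun m n c => @grid_act m n c X)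
    (fun n => @grid_act_id n X) (fun m n p d c => @grid_act_cmp m n p d c X).

Definition grids_map (X Y : semicubical_set) (h : psh_hom X Y) :
    psh_hom (grids X) (grids Y) :=
  @PshHom semicube (grids X) (grids Y) (fun n => grid_map n h)
    (fun m n c => @grid_map_act m n c X Y h).

Definition grid_face n e i X (t : grid n.+1 X) : grid n X :=
  grid_act (coface e n i) t.

Lemma grid_face0 n e X (t : grid n.+1 X) :
  grid_face e 0 t = grid_map n (path_end X e) t.
Proof. by rewrite /grid_face coface0 /= grid_act_id. Qed.

Lemma grid_face_map n e i X Y (h : psh_hom X Y) (t : grid n.+1 X) :
  grid_face e i (grid_map n.+1 h t) = grid_map n h (grid_face e i t).
Proof. by rewrite /grid_face grid_map_act. Qed.

(** * Degenerate grids *)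

(** A grid of length 0 in direction i. The value for i > n is arbitrary. *)
Fixpoint grid_degen n i {struct i} : forall X, grid n X -> grid n.+1 X :=
  match i with
  | 0 => fun X => grid_map n (path_refl X)
  | i'.+1 =>
    match n return forall X, grid n X -> grid n.+1 X with
    | 0 => fun X => grid_map 0 (path_refl X)
    | n'.+1 => fun X => @grid_degen n' i' (paths X)
    end
  end.

Lemma grid_degen_map n i X Y (h : psh_hom X Y) (t : grid n X) :
  grid_map n.+1 h (grid_degen i t) = grid_degen i (grid_map n h t).
Proof.
have H m Z Z' (h' : psh_hom Z Z') (u : grid m Z) :
    grid_map m.+1 h' (grid_map m (path_refl Z) u) =
    grid_map m (path_refl Z') (grid_map m h' u).
  by apply: (@grid_map_square m) => k x; apply: path_map_refl.
elim: i n X Y h t => [|i IH] [|n] X Y h t.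
- exact: (H 0).
- exact: (H n.+1).
- exact: (H 0).
- exact: (IH n _ _ (path_map h)).
Qed.

Lemma grid_degen_degen n i j X (t : grid n X) : i <= j -> j <= n ->
  grid_degen i (grid_degen j t) = grid_degen j.+1 (grid_degen i t).
Proof.
elim: i j n X t => [|i IH] [|j] [|n] X t //; last exact: IH.
- by move=> _ _; apply: (@grid_degen_map 0 0).
- by move=> _ _; apply: (@grid_degen_map n.+1 0).
- by move=> _ _; apply: (@grid_degen_map n.+1 j.+1).
Qed.

Lemma grid_face_degen_lt n e i j X (t : grid n.+1 X) : i <= j -> j <= n ->
  grid_face e i (grid_degen j.+1 t) = grid_degen j (grid_face e i t).
Proof.
elim: i j n X t => [|i IH] j n X t.
  by move=> _ _; rewrite !grid_face0; apply: (@grid_degen_map n j _ _ (path_end X e)).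
by case: j n t => [|j] [|n] t // *; apply: (IH j n (paths X) t).
Qed.

Lemma grid_face_degen_eq n e i X (t : grid n X) : i <= n ->
  grid_face e i (grid_degen i t) = t.
Proof.
elim: i n X t => [|i IH] [|n] X t //; last exact: IH.
- by move=> _; rewrite grid_face0; apply: path_end_refl.
- move=> _; rewrite grid_face0 -[RHS]grid_map_id.
  by apply: grid_map_triangle => k x; apply: path_end_refl.
Qed.

Lemma grid_face_degen_gt n e i j X (t : grid n.+1 X) : j <= i -> i <= n ->
  grid_face e i.+1 (grid_degen j t) = grid_degen j (grid_face e i t).
Proof.
elim: j i n X t => [|j IH] i n X t.
  by move=> _ _; exact (@grid_face_map n e i _ _ (path_refl X) t).
by case: i n t => [|i] [|n] t // *; apply: (IH i n (paths X) t).
Qed.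

Lemma path_refl_pullback X Y (h : psh_hom X Y) :
  cells_pullback (path_refl X) h (path_map h) (path_refl Y).
Proof.
split=> [n x|n p y]; first exact: path_map_refl.
case: p => [[x [|u s]] c] /(congr1 sval) //= [hx]; exists x.
by split=> [|x' [/(congr1 sval) [->]]] //; split=> //; apply: sval_inj_prop.
Qed.

(** A map of grids preserves lengths, and a grid is degenerate in a direction
    exactly when its length there is 0. *)
Lemma grid_degen_reflect n i X Y (h : psh_hom X Y) (t : grid n.+1 X)
    (u : grid n Y) : i <= n ->
  grid_map n.+1 h t = grid_degen i u -> exists v, t = grid_degen i v.
Proof.
elim: i n X Y h t u => [|i IH] n X Y h t u.
  move=> _ e; have [v [[<- _] _]] := grid_map_pullback (path_refl_pullback h) e.
  by exists v.
by case: n t u => [|n] t u //; apply: (IH n _ _ (path_map h) t u).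
Qed.

(** * Composition of grids *)

(** Composition is a relation because in the first direction it goes through a
    grid of composable pairs, which exists by [grid_map_pullback] only when the
    faces match; [grid_comp_ex] and [grid_comp_func] make it an operation. *)
Fixpoint grid_comp j n :
    forall X, grid n.+1 X -> grid n.+1 X -> grid n.+1 X -> Prop :=
  match j with
  | 0 => fun X a b c => exists w : grid n (paths2 X),
      [/\ grid_map n pbk1 w = a, grid_map n pbk2 w = b
        & grid_map n (path_cat X) w = c]
  | j'.+1 =>
    match n return forall X, grid n.+1 X -> grid n.+1 X -> grid n.+1 X -> Prop with
    | 0 => fun X a b c => False
    | n'.+1 => fun X => @grid_comp j' n' (paths X)
    end
  end.
Arguments grid_comp j {n X} a b c.

Lemma grid_comp_le j n X (a b c : grid n.+1 X) : grid_comp j a b c -> j <= n.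
Proof. by elim: j n X a b c => // j IH [|n] X a b c //; apply: IH. Qed.

Lemma grid_comp_map j n X Y (h : psh_hom X Y) (a b c : grid n.+1 X) :
  grid_comp j a b c ->
  grid_comp j (grid_map n.+1 h a) (grid_map n.+1 h b) (grid_map n.+1 h c).
Proof.
elim: j n X Y h a b c => [|j IH] n X Y h a b c; last first.
  by case: n a b c => // n a b c; apply: IH.
case=> w [<- <- <-]; exists (grid_map n (path_map2 h) w).
by split; apply: grid_map_square => // k x; rewrite path_map_cat.
Qed.

Lemma paths2_pullback X :
  cells_pullback (@pbk1 _ _ _ (path_end X true) (path_end X false)) pbk2
    (path_end X true) (path_end X false).
Proof. exact: pbk_cells_pullback. Qed.

Lemma grid_comp_ex j n X (a b : grid n.+1 X) : j <= n ->
  grid_face true j a = grid_face false j b -> exists c, grid_comp j a b c.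
Proof.
elim: j n X a b => [|j IH] n X a b; last first.
  by case: n a b => // n a b le_jn; apply: (IH n (paths X) a b).
rewrite !grid_face0 => _ /(grid_map_pullback (paths2_pullback X)) [w [[<- <-] _]].
by exists (grid_map n (path_cat X) w), w.
Qed.

Lemma grid_comp_match j n X (a b c : grid n.+1 X) :
  grid_comp j a b c -> grid_face true j a = grid_face false j b.
Proof.
elim: j n X a b c => [|j IH] n X a b c; last first.
  by case: n a b c => // n a b c; apply: (IH n (paths X) a b c).
case=> w [<- <- _]; rewrite !grid_face0; apply: grid_map_square => k x.
exact: pbkE.
Qed.

Lemma grid_comp_func j n X (a b c c' : grid n.+1 X) :
  grid_comp j a b c -> grid_comp j a b c' -> c = c'.
Proof.
elim: j n X a b c c' => [|j IH] n X a b c c'; last first.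
  by case: n a b c c' => // n a b c c'; apply: IH.
case=> w [<- <- <-] [w' [e1 e2 <-]]; congr (grid_map n (path_cat X)).
exact: grid_map_inj (paths2_pullback X) (esym e1) (esym e2).
Qed.

Lemma grid_comp_src j n X (a b c : grid n.+1 X) :
  grid_comp j a b c -> grid_face false j c = grid_face false j a.
Proof.
elim: j n X a b c => [|j IH] n X a b c; last first.
  by case: n a b c => // n a b c; apply: (IH n (paths X) a b c).
case=> w [<- _ <-]; rewrite !grid_face0; apply: grid_map_square => k x.
exact: path_end_cat.
Qed.

Lemma grid_comp_tgt j n X (a b c : grid n.+1 X) :
  grid_comp j a b c -> grid_face true j c = grid_face true j b.
Proof.
elim: j n X a b c => [|j IH] n X a b c; last first.
  by case: n a b c => // n a b c; apply: (IH n (paths X) a b c).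
case=> w [_ <- <-]; rewrite !grid_face0; apply: grid_map_square => k x.
exact: path_end_cat.
Qed.

Lemma grid_comp_face_lt i j n e X (a b c : grid n.+2 X) : i <= j ->
  grid_comp j.+1 a b c ->
  grid_comp j (grid_face e i a) (grid_face e i b) (grid_face e i c).
Proof.
elim: i j n X a b c => [|i IH] j n X a b c.
  by move=> _ H; rewrite !grid_face0; apply: (grid_comp_map (path_end X e) H).
by case: j n a b c => [|j] [|n] a b c //; apply: (IH j n (paths X) a b c).
Qed.

Lemma grid_comp_face_gt i j n e X (a b c : grid n.+2 X) : j <= i -> i <= n ->
  grid_comp j a b c ->
  grid_comp j (grid_face e i.+1 a) (grid_face e i.+1 b) (grid_face e i.+1 c).
Proof.
elim: j i n X a b c => [|j IH] i n X a b c; last first.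
  by case: i n a b c => [|i] [|n] a b c //; apply: (IH i n (paths X) a b c).
move=> _ le_in [w [<- <- <-]]; exists (grid_face e i w).
by split; apply: esym (grid_face_map e i _ w).
Qed.

Section Paths3.
Variable X : semicubical_set.

(** Composable triples of paths. *)
Definition paths3 :=
  pbk (psh_cmp (path_end X true) (@pbk2 _ _ _ (path_end X true) (path_end X false)))
    (path_end X false).

Definition paths3_12 : psh_hom paths3 (paths2 X) := pbk1.
Definition paths3_3 : psh_hom paths3 (paths X) := pbk2.

Lemma paths3E n (w : paths3 n) :
  path_end X true n (pbk2 n (paths3_12 n w)) = path_end X false n (paths3_3 n w).
Proof. exact: (pbkE w). Qed.

Definition paths3_23 : psh_hom paths3 (paths2 X) :=
  @pbk_pair _ _ _ _ _ _ (psh_cmp pbk2 paths3_12) paths3_3 paths3E.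

Lemma paths3_cat12E n (w : paths3 n) :
  path_end X true n (path_cat X n (paths3_12 n w)) =
  path_end X false n (paths3_3 n w).
Proof. by rewrite path_end_cat; apply: paths3E. Qed.

Definition paths3_cat12 : psh_hom paths3 (paths2 X) :=
  @pbk_pair _ _ _ _ _ _ (psh_cmp (path_cat X) paths3_12) paths3_3 paths3_cat12E.

Lemma paths3_cat23E n (w : paths3 n) :
  path_end X true n (pbk1 n (paths3_12 n w)) =
  path_end X false n (path_cat X n (paths3_23 n w)).
Proof. by rewrite path_end_cat; apply: (pbkE (paths3_12 n w)). Qed.

Definition paths3_cat23 : psh_hom paths3 (paths2 X) :=
  @pbk_pair _ _ _ _ _ _ (psh_cmp pbk1 paths3_12) (psh_cmp (path_cat X) paths3_23)
    paths3_cat23E.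

Lemma path_catA n (w : paths3 n) :
  path_cat X n (paths3_cat12 n w) = path_cat X n (paths3_cat23 n w).
Proof. by apply: sval_inj_prop; rewrite /= catA. Qed.
End Paths3.

(** In the first direction the three grids form one grid of composable triples,
    on which associativity is that of append. *)
Lemma grid_comp_assoc j n X (a b c ab bc abc : grid n.+1 X) :
  grid_comp j a b ab -> grid_comp j ab c abc -> grid_comp j b c bc ->
  grid_comp j a bc abc.
Proof.
elim: j n X a b c ab bc abc => [|j IH] n X a b c ab bc abc; last first.
  by case: n a b c ab bc abc => // n a b c ab bc abc; apply: IH.
move=> [u [ua ub uab]] [v [vab vc vabc]] [w [wb wc wbc]].
have [|r [[ru rc] _]] := @grid_map_pullback n _ _ _ _ _ _ _ _
    (pbk_cells_pullback (psh_cmp (path_end X true) pbk2) (path_end X false)) u c.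
  by rewrite -wc grid_map_cmp ub -wb; apply: grid_map_square => k x; apply: pbkE.
have inj := grid_map_inj (paths2_pullback X).
have rv : grid_map n (paths3_cat12 X) r = v.
  apply: inj.
  - by rewrite vab -uab -ru; apply: grid_map_square.
  - by rewrite vc -rc; apply: grid_map_triangle.
have rw : grid_map n (paths3_23 X) r = w.
  apply: inj.
  - by rewrite wb -ub -ru; apply: grid_map_square.
  - by rewrite wc -rc; apply: grid_map_triangle.
exists (grid_map n (paths3_cat23 X) r); split.
- by rewrite -ua -ru; apply: grid_map_square.
- by rewrite -wbc -rw; apply: grid_map_square.
- by rewrite -vabc -rv; apply: grid_map_square => k x; rewrite path_catA.
Qed.

Section PathUnits.
Variable X : semicubical_set.

Lemma path_unitlE n (p : paths X n) :
  path_end X true n (path_refl X n (path_end X false n p)) =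
  path_end X false n (psh_id _ n p).
Proof. exact: path_end_refl. Qed.

Definition path_unitl : psh_hom (paths X) (paths2 X) :=
  @pbk_pair _ _ _ _ _ _ (psh_cmp (path_refl X) (path_end X false)) (psh_id _)
    path_unitlE.

Lemma path_unitrE n (p : paths X n) :
  path_end X true n (psh_id _ n p) =
  path_end X false n (path_refl X n (path_end X true n p)).
Proof. exact/esym/path_end_refl. Qed.

Definition path_unitr : psh_hom (paths X) (paths2 X) :=
  @pbk_pair _ _ _ _ _ _ (psh_id _) (psh_cmp (path_refl X) (path_end X true))
    path_unitrE.
End PathUnits.

Lemma grid_comp_unitl j n X (a : grid n.+1 X) : j <= n ->
  grid_comp j (grid_degen j (grid_face false j a)) a a.
Proof.
elim: j n X a => [|j IH] n X a; last by case: n a => // n a;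
  apply: (IH n (paths X) a).
move=> _; exists (grid_map n (path_unitl X) a); rewrite grid_face0; split.
- exact: grid_map_square.
- by rewrite -[RHS](@grid_map_id n (paths X)); apply: grid_map_triangle.
- rewrite -[RHS](@grid_map_id n (paths X)); apply: grid_map_triangle => k p.
  by apply: paths_ext.
Qed.

Lemma grid_comp_unitr j n X (a : grid n.+1 X) : j <= n ->
  grid_comp j a (grid_degen j (grid_face true j a)) a.
Proof.
elim: j n X a => [|j IH] n X a; last by case: n a => // n a;
  apply: (IH n (paths X) a).
move=> _; exists (grid_map n (path_unitr X) a); rewrite grid_face0; split.
- by rewrite -[RHS](@grid_map_id n (paths X)); apply: grid_map_triangle.
- exact: grid_map_square.
- rewrite -[RHS](@grid_map_id n (paths X)); apply: grid_map_triangle => k p.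
  by apply: paths_ext; rewrite //= cats0.
Qed.

(** When i is the first direction, the pairs (a, b) and (c, d) are two grids of
    composable pairs. These can be composed in direction j, and composition in
    direction j is natural with respect to the two projections and to
    concatenation. *)
Lemma grid_comp_interchange i j n X (a b c d ab cd ac bd r : grid n.+1 X) :
  i < j -> grid_comp i a b ab -> grid_comp i c d cd -> grid_comp j a c ac ->
  grid_comp j b d bd -> grid_comp j ab cd r -> grid_comp i ac bd r.
Proof.
elim: i j n X a b c d ab cd ac bd r
  => [|i IH] [|j] [|n] X a b c d ab cd ac bd r //; last exact: IH.
move=> _ [u [ua ub uab]] [v [vc vd vcd]] Hac Hbd Hr.
have le_jn := grid_comp_le Hac.
have [|w Hw] := @grid_comp_ex j n _ u v le_jn.
  by apply: (grid_map_inj (paths2_pullback X)); rewrite -!grid_face_map;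
    [rewrite ua vc; apply: grid_comp_match Hac
    |rewrite ub vd; apply: grid_comp_match Hbd].
have Hm Y (h : psh_hom (paths2 X) Y) := grid_comp_map h Hw.
exists w; split.
- by have := Hm _ pbk1; rewrite ua vc => /grid_comp_func; apply.
- by have := Hm _ pbk2; rewrite ub vd => /grid_comp_func; apply.
- by have := Hm _ (path_cat X); rewrite uab vcd => /grid_comp_func; apply.
Qed.

Lemma grid_degen_comp_le i j n X (a b c : grid n.+1 X) : i <= j ->
  grid_comp j a b c ->
  grid_comp j.+1 (grid_degen i a) (grid_degen i b) (grid_degen i c).
Proof.
elim: i j n X a b c => [|i IH] j n X a b c.
  by move=> _ H; apply: (grid_comp_map (path_refl X) H).
by case: j n a b c => [|j] [|n] a b c //; apply: (IH j n (paths X) a b c).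
Qed.

Lemma grid_degen_comp_gt i j n X (a b c : grid n.+1 X) : j <= i ->
  grid_comp j a b c ->
  grid_comp j (grid_degen i.+1 a) (grid_degen i.+1 b) (grid_degen i.+1 c).
Proof.
elim: j i n X a b c => [|j IH] i n X a b c; last first.
  by case: i n a b c => [|i] [|n] a b c //; apply: (IH i n (paths X) a b c).
move=> _ [w [<- <- <-]]; exists (grid_degen i w).
by split; apply: (grid_degen_map i _ w).
Qed.

(** A decomposition of the image of a path lifts uniquely: the list is cut at
    the same place. *)
Lemma path_cat_pullback X Y (h : psh_hom X Y) :
  cells_pullback (path_cat X) (path_map2 h) (path_map h) (path_cat Y).
Proof.
split=> [n w|n p w]; first exact: path_map_cat.
case: p w => [[x s] c] [[[[y t] d] [[y' t'] d']] m] e /=.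
have [ex es] : h n x = y /\ map (h n.+1) s = t ++ t'.
  by move: e => /(congr1 sval) [].
have [s1 [s2 [es1 es2 e0]]] :
    exists s1 s2, [/\ map (h n.+1) s1 = t, map (h n.+1) s2 = t' & s = s1 ++ s2].
  (* The path is cut where the concatenation in Y was cut. *)
  exists (take (size t) s), (drop (size t) s).
  by rewrite map_take map_drop es take_size_cat // drop_size_cat // cat_take_drop.
subst s; have [c1 c2] := (chain_cat x s1 s2).1 c.
have fg : path_end X true n (exist _ (x, s1) c1) =
    path_end X false n (exist _ (chain_end true x s1, s2) c2) by [].
exists (exist _ (_, _) fg); split.
  split; first exact: sval_inj_prop.
  apply: pbk_inj; apply: paths_ext => //=.
  rewrite -/(chain_end true x s1) -(@chain_end_map _ _ _ _ (h n) (h n.+1)).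
    by rewrite es1 ex; apply: m.
  by move=> b z; rewrite (hom_face h).
move=> [[[[x1 r1] k1] [[x2 r2] k2]] l] [] /(congr1 sval) [e1 e2] /(congr1 sval) /=.
case=> [_ er1] [_ er2].
have [f1 f2] : s1 = r1 /\ s2 = r2.
  (* Both cuts are at the length of t, as h preserves lengths. *)
  have sz : size s1 = size r1.
    by rewrite -[RHS](size_map (h n.+1)) er1 -es1 size_map.
  by split; [have := congr1 (take (size s1)) e2; rewrite sz !take_size_cat
            |have := congr1 (drop (size s1)) e2; rewrite sz !drop_size_cat].
subst; apply: pbk_inj; apply: paths_ext => //=; exact/esym/l.
Qed.

Lemma grid_comp_reflect j n X Y (h : psh_hom X Y) (t : grid n.+1 X)
    (b1 b2 : grid n.+1 Y) :
  grid_comp j b1 b2 (grid_map n.+1 h t) ->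
  exists a1 a2, [/\ grid_comp j a1 a2 t, grid_map n.+1 h a1 = b1
                  & grid_map n.+1 h a2 = b2].
Proof.
elim: j n X Y h t b1 b2 => [|j IH] n X Y h t b1 b2; last first.
  by case: n t b1 b2 => // n t b1 b2; apply: IH.
case=> w [<- <- e].
have [v [[vt vw] _]] := grid_map_pullback (path_cat_pullback h) (esym e).
exists (grid_map n pbk1 v), (grid_map n pbk2 v); split; first by exists v.
- by rewrite -vw; apply: (@grid_map_square n).
- by rewrite -vw; apply: (@grid_map_square n).
Qed.

Lemma grid_comp_reflect_uniq j n X Y (h : psh_hom X Y)
    (t a1 a2 a1' a2' : grid n.+1 X) :
  grid_comp j a1 a2 t -> grid_comp j a1' a2' t ->
  grid_map n.+1 h a1 = grid_map n.+1 h a1' ->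
  grid_map n.+1 h a2 = grid_map n.+1 h a2' -> a1 = a1' /\ a2 = a2'.
Proof.
elim: j n X Y h t a1 a2 a1' a2' => [|j IH] n X Y h t a1 a2 a1' a2'; last first.
  by case: n t a1 a2 a1' a2' => // n t a1 a2 a1' a2'; apply: IH.
case=> v [<- <- vt] [v' [<- <- v't]] e1 e2.
suff -> : v = v' by [].
apply: (grid_map_inj (path_cat_pullback h)); first by rewrite vt v't.
apply: (grid_map_inj (paths2_pullback Y)).
  have E u : grid_map n pbk1 (grid_map n (path_map2 h) u) =
             grid_map n.+1 h (grid_map n pbk1 u) by apply: (@grid_map_square n).
  by rewrite !E.
have E u : grid_map n pbk2 (grid_map n (path_map2 h) u) =
           grid_map n.+1 h (grid_map n pbk2 u) by apply: (@grid_map_square n).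
by rewrite !E.
Qed.

(** * The omega-category of grids *)

Section GridOmega.
Variable X : semicubical_set.

Definition grid_cubical : cubical_set.
Proof.
refine (@CubicalSet (grids X) (fun n i => @grid_degen n i X) _ _ _ _).
- move=> n i j i' j' x le_ij /= -> ->.
  by apply: grid_degen_degen le_ij _; rewrite -ltnS.
- move=> n e i j i' j' x lt_ij /= ei' ej; rewrite /face /= -ei' ej.
  apply: grid_face_degen_lt; first by rewrite ei' -ltnS -ej.
  by rewrite -ltnS.
- move=> n e i x; apply: grid_face_degen_eq; by rewrite -ltnS.
- move=> n e i j i' j' x lt_ji /= ei ej'; rewrite /face /= ei ej'.
  apply: grid_face_degen_gt; first by rewrite -ltnS -ei.
  by rewrite -ltnS.
Defined.

Definition grid_ccmp n (j : 'I_n.+1) (a b : grid_cubical n.+1)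
    (H : face grid_cubical true j a = face grid_cubical false j b) :
    grid_cubical n.+1 :=
  sval (cid (grid_comp_ex (ltn_ord j : j <= n) H)).

Lemma grid_ccmpP n (j : 'I_n.+1) a b H : grid_comp j a b (@grid_ccmp n j a b H).
Proof. exact: svalP (cid _). Qed.

Lemma grid_ccmpE n (j : 'I_n.+1) (a b c : grid n.+1 X) H :
  grid_comp j a b c -> @grid_ccmp n j a b H = c.
Proof. exact: grid_comp_func (grid_ccmpP H). Qed.

Definition grid_omega : cubical_omega_category.
Proof.
refine (@CubicalOmegaCategory grid_cubical grid_ccmp _ _ _ _ _ _ _ _ _ _).
- by move=> n j a b H; apply: grid_comp_src (grid_ccmpP H).
- by move=> n j a b H; apply: grid_comp_tgt (grid_ccmpP H).
- move=> n e i j j' a b H H' lt_ij ej; apply/esym/grid_ccmpE.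
  apply: grid_comp_face_lt; first by rewrite -ltnS -ej.
  by rewrite -ej; apply: grid_ccmpP.
- move=> n e [[|i] lt_i] j j' a b H H' //= lt_ji ej'; apply/esym/grid_ccmpE.
  by rewrite ej'; apply: grid_comp_face_gt => //; apply: grid_ccmpP.
- move=> n j a b c H1 H2 H3 H4; apply/esym/grid_ccmpE.
  exact: grid_comp_assoc (grid_ccmpP H1) (grid_ccmpP H2) (grid_ccmpP H3).
- move=> n j a H; apply: grid_ccmpE; apply: grid_comp_unitl; exact: ltn_ord j.
- move=> n j a H; apply: grid_ccmpE; apply: grid_comp_unitr; exact: ltn_ord j.
- move=> n i j a b c d H1 H2 H3 H4 H5 H6; rewrite neq_ltn => /orP [lt_ij|lt_ji].
    apply/esym/grid_ccmpE.
    exact: grid_comp_interchange lt_ij (grid_ccmpP H1) (grid_ccmpP H2)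
      (grid_ccmpP H4) (grid_ccmpP H5) (grid_ccmpP H3).
  apply/grid_ccmpE.
  exact: grid_comp_interchange lt_ji (grid_ccmpP H4) (grid_ccmpP H5)
    (grid_ccmpP H1) (grid_ccmpP H2) (grid_ccmpP H6).
- move=> n j i j' a b H H' le_ij ej'; apply/esym; apply: (@grid_ccmpE n.+1).
  by rewrite ej'; apply: grid_degen_comp_le le_ij (grid_ccmpP H).
- move=> n j [[|i] lt_i] j' a b H H' //= lt_ji ej'; apply/esym;
  apply: (@grid_ccmpE n.+1).
  by rewrite ej'; apply: grid_degen_comp_gt (grid_ccmpP H).
Defined.
End GridOmega.

Lemma ccmp_congr (A : cubical_omega_category) n (j : 'I_n.+1)
    (a b a' b' : A n.+1) H H' :
  a = a' -> b = b' -> ccmp A j a b H = ccmp A j a' b' H'.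
Proof. by move=> ea eb; subst; congr ccmp; apply: Prop_irrelevance. Qed.

(** * Shifting an omega-category *)

Section OmegaShift.
Variable A : cubical_omega_category.

Definition cubical_shift : cubical_set.
Proof.
refine (@CubicalSet (shift A)
  (fun n i (x : shift A n) => degen A (lift ord0 i) x) _ _ _ _).
- move=> n i j i' j' x le_ij ei' ej'.
  exact (@degen_degen A n.+1 (lift ord0 i) (lift ord0 j) (lift ord0 i')
    (lift ord0 j') x le_ij (congr1 S ei') (congr1 S ej')).
- move=> n e i j i' j' x lt_ij ei' ej.
  exact (@face_degen_lt A n.+1 e (lift ord0 i) (lift ord0 j) (lift ord0 i')
    (lift ord0 j') x lt_ij (congr1 S ei') (congr1 S ej)).
- move=> n e i x; exact (@face_degen_eq A n.+1 e (lift ord0 i) x).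
- move=> n e i j i' j' x lt_ji ei ej'.
  exact (@face_degen_gt A n.+1 e (lift ord0 i) (lift ord0 j) (lift ord0 i')
    (lift ord0 j') x lt_ji (congr1 S ei) (congr1 S ej')).
Defined.

(** The composition of A in its first direction is lost here; it gives the map
    [path_comp] from [paths A]. *)
Definition omega_shift : cubical_omega_category.
Proof.
refine (@CubicalOmegaCategory cubical_shift
  (fun n j (a b : shift A n.+1) H => ccmp A (lift ord0 j) a b H)
  _ _ _ _ _ _ _ _ _ _).
- move=> n j; exact (@face_ccmp_src A n.+1 (lift ord0 j)).
- move=> n j; exact (@face_ccmp_tgt A n.+1 (lift ord0 j)).
- move=> n e i j j' a b H H' lt_ij ej.
  exact (@face_ccmp_lt A n.+1 e (lift ord0 i) (lift ord0 j) (lift ord0 j')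
    a b H H' lt_ij (congr1 S ej)).
- move=> n e i j j' a b H H' lt_ji ej'.
  exact (@face_ccmp_gt A n.+1 e (lift ord0 i) (lift ord0 j) (lift ord0 j')
    a b H H' lt_ji (congr1 S ej')).
- move=> n j; exact (@ccmp_assoc A n.+1 (lift ord0 j)).
- move=> n j; exact (@ccmp_unitl A n.+1 (lift ord0 j)).
- move=> n j; exact (@ccmp_unitr A n.+1 (lift ord0 j)).
- move=> n i j a b c d H1 H2 H3 H4 H5 H6 ne_ij.
  apply: (@ccmp_interchange A n.+1 (lift ord0 i) (lift ord0 j)).
  by rewrite (inj_eq lift_inj).
- move=> n j i j' a b H H' le_ij ej'.
  exact (@degen_ccmp_le A n.+1 (lift ord0 j) (lift ord0 i) (lift ord0 j')
    a b H H' le_ij (congr1 S ej')).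
- move=> n j i j' a b H H' lt_ji ej'.
  exact (@degen_ccmp_gt A n.+1 (lift ord0 j) (lift ord0 i) (lift ord0 j')
    a b H H' lt_ji (congr1 S ej')).
Defined.
End OmegaShift.

(** * Composing the edges of a path *)

Section PathComposite.
Variable A : cubical_omega_category.

(** A total version of composition in the first direction, which can be iterated
    along a list before its elements are known to be composable. *)
Definition comp0 n (a b : A n.+1) : A n.+1 :=
  if pselect (face A true ord0 a = face A false ord0 b) is left H
  then ccmp A ord0 a b H else a.

Lemma comp0E n (a b : A n.+1) H : comp0 a b = ccmp A ord0 a b H.
Proof. by rewrite /comp0; case: pselect => // H'; apply: ccmp_congr. Qed.

Fixpoint chain_comp n (x : A n) (s : seq (A n.+1)) : A n.+1 :=
  if s is e :: s' then comp0 e (chain_comp (face A true ord0 e) s')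
  else degen A ord0 x.

Lemma chain_comp_end n e (x : A n) s : chain x s ->
  face A e ord0 (chain_comp x s) = chain_end e x s.
Proof.
elim: s x e => /= [x e _|u s IH x e [<- c]].
  by rewrite face_degen_eq; case: e.
have H := esym (IH _ false c); rewrite (comp0E H).
by case: e; [rewrite face_ccmp_tgt IH|exact: face_ccmp_src].
Qed.
End PathComposite.

(** Stated for maps between different dimensions, so as to apply both to the
    faces of A and to maps of omega-categories. *)
Lemma chain_comp_map (A B : cubical_omega_category) m n (h : A n -> B m)
    (h1 : A n.+1 -> B m.+1) :
    (forall e x, face B e ord0 (h1 x) = h (face A e ord0 x)) ->
    (forall x, h1 (degen A ord0 x) = degen B ord0 (h x)) ->
    (forall a b H H', h1 (ccmp A ord0 a b H) = ccmp B ord0 (h1 a) (h1 b) H') ->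
  forall x s, chain x s ->
  h1 (chain_comp x s) = chain_comp (h x) (map h1 s).
Proof.
move=> hf hs hc x s; elim: s x => //= u s IH x [_ c].
have H : face A true ord0 u =
    face A false ord0 (chain_comp (face A true ord0 u) s).
  exact: esym (chain_comp_end false c).
rewrite (comp0E H) hf -IH //.
have H' : face B true ord0 (h1 u) =
    face B false ord0 (h1 (chain_comp (face A true ord0 u) s)).
  by rewrite !hf; congr h.
by rewrite (comp0E H'); apply: hc.
Qed.

Lemma chain_comp_cat (A : cubical_omega_category) n (x : A n) s t :
  chain x s -> chain (chain_end true x s) t ->
  exists H, ccmp A ord0 (chain_comp x s) (chain_comp (chain_end true x s) t) H =
    chain_comp x (s ++ t).
Proof.
elim: s x => [|u s IH] x.
  move=> _ c /=.
  have E := chain_comp_end false c; rewrite /chain_end /= in E.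
  have H : face A true ord0 (degen A ord0 x) = face A false ord0 (chain_comp x t).
    by rewrite face_degen_eq E.
  have Hu : face A true ord0 (degen A ord0 (face A false ord0 (chain_comp x t))) =
      face A false ord0 (chain_comp x t) by rewrite face_degen_eq.
  by exists H; rewrite -[RHS](ccmp_unitl Hu); apply: ccmp_congr; rewrite ?E.
rewrite [chain x _]/= => -[_ cs] ct.
have [H e] := IH _ cs ct; rewrite /= -e.
have Hu : face A true ord0 u =
    face A false ord0 (chain_comp (face A true ord0 u) s).
  exact: esym (chain_comp_end false cs).
rewrite (comp0E Hu).
have Hu' : face A true ord0 u = face A false ord0 (ccmp A ord0 _ _ H).
  by rewrite face_ccmp_src.
rewrite (comp0E Hu').
have H2 : face A true ord0 (ccmp A ord0 _ _ Hu) =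
    face A false ord0 (chain_comp (chain_end true (face A true ord0 u) s) t).
  by rewrite face_ccmp_tgt.
exists H2; exact: ccmp_assoc.
Qed.

Section PathComp.
Variable A : cubical_omega_category.

Lemma path_comp_nat m n (f : cube_hom m n) (p : paths A n) :
  chain_comp (sval (act (paths A) f p)).1 (sval (act (paths A) f p)).2 =
  act (shift A) f (chain_comp (sval p).1 (sval p).2).
Proof.
elim/semicube_ind: f p => {m n} [n p|m n k g f IHg IHf p|e n i le_in p].
- by rewrite !(@act_id semicube).
- by rewrite !(@act_cmp semicube) IHf IHg.
- rewrite -ltnS in le_in; pose j : 'I_n.+1 := Ordinal le_in.
  apply/esym.
  apply: (@chain_comp_map A A n n.+1 (face A e j) (face A e (lift ord0 j)));
    last exact: svalP p.
  + by move=> e' x; apply: (face0_wire e' (coface e n i) x).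
  + by move=> x; apply: face_degen_gt.
  + by move=> a b H H'; apply: face_ccmp_gt.
Qed.

(** It preserves faces in the remaining directions because faces of composites
    are composites of faces. *)
Definition path_comp : psh_hom (paths A) (shift A) :=
  @PshHom semicube (paths A) (shift A)
    (fun n p => chain_comp (sval p).1 (sval p).2) path_comp_nat.

Lemma path_comp_end e n (p : paths A n) :
  face0 A e n (path_comp n p) = path_end A e n p.
Proof. exact: chain_comp_end (svalP p). Qed.

Lemma path_comp_edge n (x : shift A n) : path_comp n (path_edge A n x) = x.
Proof.
have H : face A true ord0 x =
    face A false ord0 (degen A ord0 (face A true ord0 x)).
  by rewrite face_degen_eq.
rewrite /= (comp0E H); exact: ccmp_unitr.
Qed.

Lemma path_comp_cat n (w : paths2 A n) :
  exists H, ccmp A ord0 (path_comp n (pbk1 n w)) (path_comp n (pbk2 n w)) H =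
    path_comp n (path_cat A n w).
Proof.
case: w => [[[[x s] c] [[y t] d]] m].
have E : chain_end true x s = y by exact: m.
by subst y; have [H e] := chain_comp_cat c d; exists H.
Qed.

Lemma degen0_nat m n (f : cube_hom m n) (x : A n) :
  degen A ord0 (act A f x) = act (shift A) f (degen A ord0 x).
Proof.
elim/semicube_ind: f x => {m n} [n x|m n k g f IHg IHf x|e n i le_in x].
- by rewrite !(@act_id semicube).
- by rewrite !(@act_cmp semicube) IHf IHg.
- rewrite -ltnS in le_in; pose j : 'I_n.+1 := Ordinal le_in.
  by apply/esym; apply: (@face_degen_gt A n e (lift ord0 j) ord0 j ord0).
Qed.

Definition degen0 : psh_hom A (shift A) :=
  @PshHom semicube A (shift A) (fun n => degen A ord0) degen0_nat.

Lemma degen0_omega : @is_omega_map A (omega_shift A) degen0.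
Proof.
split=> [n i x|n j a b H H']; first exact: (@degen_degen A n ord0 i).
exact: (@degen_ccmp_le A n j ord0 (lift ord0 j)).
Qed.

Lemma face0_omega e : @is_omega_map (omega_shift A) A (face0 A e).
Proof.
split=> [n i x|n j a b H H'].
  exact: (@face_degen_lt A n e ord0 (lift ord0 i) ord0 i).
exact: (@face_ccmp_lt A n e ord0 (lift ord0 j) j).
Qed.
End PathComp.

Lemma shift_map_omega (A B : cubical_omega_category) (g : psh_hom A B) :
  is_omega_map g -> @is_omega_map (omega_shift A) (omega_shift B) (shift_map g).
Proof. by move=> [gs gc]; split=> [n i x|n j a b H H']; [apply: gs|apply: gc]. Qed.

Lemma path_comp_map (A B : cubical_omega_category) (g : psh_hom A B) n
    (p : paths A n) : is_omega_map g ->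
  g n.+1 (path_comp A n p) = path_comp B n (path_map g n p).
Proof.
move=> [gs gc]; apply: chain_comp_map (svalP p) => //.
by move=> e x; rewrite (hom_face g).
Qed.

(** * Evaluating grids in an omega-category *)

(** The composite of all the cells of a grid: the rows in the first direction
    are composed, and what remains is a grid in the shifted omega-category. *)
Fixpoint eval n : forall A : cubical_omega_category, grid n A -> A n :=
  match n with
  | 0 => fun A t => t
  | n'.+1 => fun A t => @eval n' (omega_shift A) (grid_map n' (path_comp A) t)
  end.
Arguments eval n A t : clear implicits.

Lemma eval_map n (A B : cubical_omega_category) (g : psh_hom A B) (t : grid n A) :
  is_omega_map g -> g n (eval n A t) = eval n B (grid_map n g t).
Proof.
elim: n A B g t => [//|n IH] A B g t gP.
apply: etrans (IH (omega_shift A) (omega_shift B) (shift_map g)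
  (grid_map n (path_comp A) t) (shift_map_omega gP)) _.
congr (eval n (omega_shift B) _); apply: grid_map_square => k p.
exact: path_comp_map.
Qed.

(** The faces in the first direction are maps of omega-categories from
    [omega_shift A] to A, with which evaluation commutes by [eval_map]. *)
Lemma eval_act m n (c : cube_hom m n) (A : cubical_omega_category) (t : grid n A) :
  eval m A (grid_act c t) = act A c (eval n A t).
Proof.
elim: c A t => [A t|{}m {}n e c IH A t|{}m {}n c IH A t].
- by rewrite [RHS](@act_id semicube A 0).
- rewrite act_cube_face /= IH; congr (act A c _).
  rewrite [RHS](eval_map _ (face0_omega A e)); congr eval.
  by apply/esym/grid_map_triangle => k p; apply: path_comp_end.
- by rewrite /= grid_map_act; apply: (IH (omega_shift A)).
Qed.

Definition eval_hom (A : cubical_omega_category) : psh_hom (grids A) A :=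
  @PshHom semicube (grids A) A (fun n => eval n A)
    (fun m n c => @eval_act m n c A).

Lemma eval_degen n (A : cubical_omega_category) (i : 'I_n.+1) (t : grid n A) :
  eval n.+1 A (grid_degen i t) = degen A i (eval n A t).
Proof.
elim: n A i t => [|n IH] A i t; case: (unliftP ord0 i) => [j ->|->].
- by case: j.
- by [].
- apply: etrans (IH (omega_shift A) j (grid_map n (path_comp A) t)).
  congr (eval n.+1 (omega_shift A) _); exact: grid_degen_map.
- rewrite [RHS](eval_map t (degen0_omega A)).
  congr (eval n.+1 (omega_shift A) _).
  exact: (@grid_map_triangle n.+1).
Qed.

Section StableRelations.

(** A stable relation is a subobject of A x A x A in omega-categories.
    Evaluating a grid of related triples yields related triples, and applied to
    the graph of the composition in the first direction this shows that
    evaluation preserves composites, without constructing products or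
    pullbacks of omega-categories. *)
Record stable (A : cubical_omega_category)
    (R : forall n, A n -> A n -> A n -> Prop) : Prop := Stable {
  stable_act : forall m n (c : cube_hom m n) x y z,
    R n x y z -> R m (act A c x) (act A c y) (act A c z);
  stable_degen : forall n (i : 'I_n.+1) x y z,
    R n x y z -> R n.+1 (degen A i x) (degen A i y) (degen A i z);
  stable_ccmp : forall n (j : 'I_n.+1) x y z x' y' z' Hx Hy Hz,
    R n.+1 x y z -> R n.+1 x' y' z' ->
    R n.+1 (ccmp A j x x' Hx) (ccmp A j y y' Hy) (ccmp A j z z' Hz) }.

Variables (A : cubical_omega_category) (R : forall n, A n -> A n -> A n -> Prop).
Arguments R : clear implicits.

Lemma stable_shift : stable R ->
  stable (A := omega_shift A) (fun n : nat => R n.+1).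
Proof.
case=> Ra Rs Rc; split.
- by move=> m n c; apply: (Ra m.+1 n.+1 (cube_wire c)).
- by move=> n i; apply: (Rs n.+1 (lift ord0 i)).
- by move=> n j *; apply: (Rc n.+1 (lift ord0 j)).
Qed.

Hypothesis RS : stable R.

Definition graph_cell n := {x : A n * A n * A n | R n x.1.1 x.1.2 x.2}.

Definition graph_act m n (c : cube_hom m n) (x : graph_cell n) : graph_cell m :=
  exist (fun x => R m x.1.1 x.1.2 x.2)
    (act A c (sval x).1.1, act A c (sval x).1.2, act A c (sval x).2)
    (stable_act RS c (svalP x)).

Lemma graph_act_id n (x : graph_cell n) : graph_act (cube_id n) x = x.
Proof.
case: x => [[[x y] z] r]; apply: sval_inj_prop => /=.
by rewrite !(@act_id semicube).
Qed.

Lemma graph_act_cmp m n p (d : cube_hom n p) (c : cube_hom m n) (x : graph_cell p) :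
  graph_act (cube_cmp d c) x = graph_act c (graph_act d x).
Proof. by apply: sval_inj_prop; rewrite /= !act_cube_cmp. Qed.

Definition graph : semicubical_set :=
  @Presheaf semicube graph_cell graph_act graph_act_id graph_act_cmp.

Definition graph_x : psh_hom graph A :=
  @PshHom semicube graph A (fun n w => (sval w).1.1) (fun m n c w => erefl).
Definition graph_y : psh_hom graph A :=
  @PshHom semicube graph A (fun n w => (sval w).1.2) (fun m n c w => erefl).
Definition graph_z : psh_hom graph A :=
  @PshHom semicube graph A (fun n w => (sval w).2) (fun m n c w => erefl).

Section Lift.
Variables (W : semicubical_set) (u v w : psh_hom W A).
Hypothesis uvw : forall n x, R n (u n x) (v n x) (w n x).

Definition graph_lift_cell n (x : W n) : graph n :=
  exist (fun x => R n x.1.1 x.1.2 x.2) (u n x, v n x, w n x) (uvw x).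

Lemma graph_lift_nat m n (c : cube_hom m n) x :
  graph_lift_cell (act W c x) = act graph c (graph_lift_cell x).
Proof. by apply: sval_inj_prop; rewrite /= !hom_act. Qed.

Definition graph_lift : psh_hom W graph :=
  @PshHom semicube W graph graph_lift_cell graph_lift_nat.
End Lift.

Lemma graph_chain_comp n (w : graph n) s : chain w s ->
  R n.+1 (chain_comp (graph_x n w) (map (graph_x n.+1) s))
         (chain_comp (graph_y n w) (map (graph_y n.+1) s))
         (chain_comp (graph_z n w) (map (graph_z n.+1) s)).
Proof.
elim: s w => [|u s IH] w; first by move=> _; apply: stable_degen (svalP w).
move=> [_ c]; have Ru := svalP u; have Rs := IH _ c.
have M (h : psh_hom graph A) : face A true ord0 (h n.+1 u) = face A false ord0
    (chain_comp (face A true ord0 (h n.+1 u)) (map (h n.+1) s)).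
  apply: esym; apply: (@chain_comp_end A n false); rewrite -(hom_face h).
  by apply: chain_map c => e x; rewrite (hom_face h).
rewrite /= (comp0E (M graph_x)) (comp0E (M graph_y)) (comp0E (M graph_z)).
exact: stable_ccmp.
Qed.
End StableRelations.

Definition graph_path_comp (A : cubical_omega_category)
    (R : forall n, A n -> A n -> A n -> Prop) (RS : stable R) :
    psh_hom (paths (graph RS)) (graph (stable_shift RS)) :=
  @graph_lift (omega_shift A) _ (stable_shift RS) _
    (psh_cmp (path_comp A) (path_map (graph_x RS)))
    (psh_cmp (path_comp A) (path_map (graph_y RS)))
    (psh_cmp (path_comp A) (path_map (graph_z RS)))
    (fun n p => graph_chain_comp (svalP p)).

Lemma eval_stable n (A : cubical_omega_category)
    (R : forall n, A n -> A n -> A n -> Prop) (RS : stable R)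
    (t : grid n (graph RS)) :
  R n (eval n A (grid_map n (graph_x RS) t))
      (eval n A (grid_map n (graph_y RS) t))
      (eval n A (grid_map n (graph_z RS) t)).
Proof.
elim: n A R RS t => [|n IH] A R RS t; first exact: svalP t.
have := IH (omega_shift A) _ (stable_shift RS) (grid_map n (graph_path_comp RS) t).
have E (h : psh_hom (graph RS) A) (h' : psh_hom (graph (stable_shift RS)) (shift A)) :
    (forall m p, h' m (graph_path_comp RS m p) = path_comp A m (path_map h m p)) ->
   eval n (omega_shift A) (grid_map n h' (grid_map n (graph_path_comp RS) t)) =
   eval n.+1 A (grid_map n.+1 h t).
  by move=> e; congr (eval n (omega_shift A) _); apply: grid_map_square.
by rewrite (E (graph_x RS)) // (E (graph_y RS)) // (E (graph_z RS)).
Qed.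

Section Comp0.
Variable A : cubical_omega_category.

Definition comp0_rel n (x y z : omega_shift A n) : Prop :=
  exists H, ccmp A ord0 x y H = z.

(** Stability under faces, degeneracies and composition in the other directions
    is what the axioms of A say of its first composition; the last of the three
    is the interchange law. *)
Lemma comp0_rel_stable : stable comp0_rel.
Proof.
split.
- move=> m n c; elim/semicube_ind: c => {m n} [n|m n k g f IHg IHf|e n i le_in] x y z.
  + by rewrite !(@act_id semicube).
  + by rewrite !act_cube_cmp => /IHg/IHf.
  + rewrite -ltnS in le_in; pose j : 'I_n.+1 := Ordinal le_in.
    move=> [H <-].
    have H' : face A true ord0 (face A e (lift ord0 j) x) =
              face A false ord0 (face A e (lift ord0 j) y).
      have E b u : face A b ord0 (face A e (lift ord0 j) u) =
          face A e j (face A b ord0 u) := face0_wire b (coface e n i) u.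
      by rewrite !E H.
    by exists H'; apply/esym/(@face_ccmp_gt A n e (lift ord0 j) ord0 ord0).
- move=> n i x y z [H <-].
  have H' : face A true ord0 (degen A (lift ord0 i) x) =
            face A false ord0 (degen A (lift ord0 i) y).
    by rewrite !(@face_degen_lt A n _ ord0 (lift ord0 i) ord0 i) // H.
  by exists H'; apply/esym/(@degen_ccmp_gt A n ord0 (lift ord0 i) ord0).
- move=> n j x y z x' y' z' Hx Hy Hz [H e] [H' e']; subst z z'.
  have E b u v (Huv : face A true (lift ord0 j) u =
    face A false (lift ord0 j) v) Hbuv :
      face A b ord0 (ccmp A (lift ord0 j) u v Huv) =
      ccmp A j (face A b ord0 u) (face A b ord0 v) Hbuv.
    exact: (@face_ccmp_lt A n b ord0 (lift ord0 j) j).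
  have M b u v (Huv : face A true (lift ord0 j) u = face A false (lift ord0 j) v) :
      face A true j (face A b ord0 u) = face A false j (face A b ord0 v).
    have F c w : face A c j (face A b ord0 w) =
      face A b ord0 (face A c (lift ord0 j) w).
      by apply/esym/(@face_face A n b c ord0 j ord0 (lift ord0 j)).
    by rewrite !F Huv.
  have H0 : face A true ord0 (ccmp A (lift ord0 j) x x' Hx) =
            face A false ord0 (ccmp A (lift ord0 j) y y' Hy).
    by rewrite (E _ _ _ Hx (M _ _ _ Hx)) (E _ _ _ Hy (M _ _ _ Hy)); apply: ccmp_congr.
  by exists H0; apply: (@ccmp_interchange A n.+1 (lift ord0 j) ord0).
Qed.

Definition path_comp_graph : psh_hom (paths2 A) (graph comp0_rel_stable) :=
  @graph_lift (omega_shift A) _ comp0_rel_stable _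
    (psh_cmp (path_comp A) pbk1) (psh_cmp (path_comp A) pbk2)
    (psh_cmp (path_comp A) (path_cat A)) (fun n w => path_comp_cat w).
End Comp0.

(** In the first direction, a composable pair of grids is a grid of triples
    related by [comp0_rel], to which [eval_stable] applies. *)
Lemma eval_comp j n (A : cubical_omega_category) (j' : 'I_n.+1)
    (a b c : grid n.+1 A) : j' = j :> nat -> grid_comp j a b c ->
  exists H, ccmp A j' (eval n.+1 A a) (eval n.+1 A b) H = eval n.+1 A c.
Proof.
elim: j n A j' a b c => [|j IH] n A j' a b c;
  case: (unliftP ord0 j') => [i|] -> // {j'}.
  move=> _ [w [<- <- <-]].
  have := eval_stable (grid_map n (path_comp_graph A) w).
  have E (h : psh_hom (paths2 A) (paths A))
      (h' : psh_hom (graph (comp0_rel_stable A)) (shift A)) :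
      (forall m p, h' m (path_comp_graph A m p) = path_comp A m (h m p)) ->
     eval n (omega_shift A) (grid_map n h' (grid_map n (path_comp_graph A) w)) =
     eval n.+1 A (grid_map n h w).
    by move=> e; congr (eval n (omega_shift A) _); apply: grid_map_square.
  by rewrite (E pbk1) // (E pbk2) // (E (path_cat A)).
case: n i a b c => [[[]]|n] // i a b c [ei] H.
exact: (IH n (omega_shift A) i _ _ _ ei (grid_comp_map (path_comp A) H)).
Qed.

Lemma eval_omega (A : cubical_omega_category) :
  @is_omega_map (grid_omega A) A (eval_hom A).
Proof.
split=> [n i t|n j a b H H']; first exact: eval_degen.
have [H2 e] := eval_comp (erefl (j : nat)) (grid_ccmpP H).
by apply: etrans (esym e) _; apply: ccmp_congr.
Qed.

(** * Cells as grids *)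

(** The grid with all lengths 1. *)
Fixpoint unit_grid n : forall X : semicubical_set, X n -> grid n X :=
  match n with
  | 0 => fun X x => x
  | n'.+1 => fun X x => grid_map n' (path_edge X) (@unit_grid n' (shift X) x)
  end.
Arguments unit_grid n X x : clear implicits.

Lemma unit_grid_map n (X Y : semicubical_set) (h : psh_hom X Y) (x : X n) :
  grid_map n h (unit_grid n X x) = unit_grid n Y (h n x).
Proof.
elim: n X Y h x => [//|n IH] X Y h x.
have := IH (shift X) (shift Y) (shift_map h) x.
rewrite [unit_grid n.+1 Y _]/= => <-.
by apply: (@grid_map_square n) => k y; apply: path_map_edge.
Qed.

Lemma unit_grid_act m n (c : cube_hom m n) (X : semicubical_set) (x : X n) :
  unit_grid m X (act X c x) = grid_act c (unit_grid n X x).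
Proof.
elim: c X x => [X x|{}m {}n e c IH X x|{}m {}n c IH X x].
- by rewrite (@act_id semicube X 0).
- rewrite act_cube_face IH /=; congr grid_act.
  rewrite -[RHS]/(grid_map n (path_end X e) (grid_map n (path_edge X) _)).
  rewrite (grid_map_triangle (h := face0 X e)) ?unit_grid_map // => k y.
  exact: path_end_edge.
- by rewrite /= -grid_map_act -IH.
Qed.

Definition unit_grid_hom (X : semicubical_set) : psh_hom X (grids X) :=
  @PshHom semicube X (grids X) (fun n => unit_grid n X)
    (fun m n c => @unit_grid_act m n c X).

Lemma eval_unit_grid n (A : cubical_omega_category) (x : A n) :
    eval n A (unit_grid n A x) = x.
Proof.
elim: n A x => [//|n IH] A x; apply: etrans (IH (omega_shift A) x).
congr (eval n (omega_shift A) _); rewrite -[RHS]grid_map_id.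
by apply: grid_map_triangle => k y; apply: path_comp_edge.
Qed.

Lemma grids_map_omega (X Y : semicubical_set) (h : psh_hom X Y) :
  @is_omega_map (grid_omega X) (grid_omega Y) (grids_map h).
Proof.
split=> [n i t|n j a b H H']; first exact: grid_degen_map.
by apply/esym/grid_ccmpE; apply: grid_comp_map (grid_ccmpP H).
Qed.

Section Uniqueness.
Variables (X : semicubical_set) (A : cubical_omega_category).
Variable h : psh_hom (grids X) A.
Hypothesis hP : @is_omega_map (grid_omega X) A h.

Definition shift_grids : psh_hom (grids (paths X)) (shift A) :=
  @PshHom semicube (grids (paths X)) (shift A) (fun n => h n.+1)
    (fun m n c => hom_act h (cube_wire c)).

Lemma shift_grids_omega :
  @is_omega_map (grid_omega (paths X)) (omega_shift A) shift_grids.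
Proof.
case: hP => hs hc; split=> [n i t|n j a b H H'].
  exact: (hs n.+1 (lift ord0 i)).
apply: etrans (hc n.+1 (lift ord0 j) a b H H'); congr (h n.+2 _).
exact: (@grid_ccmpE (paths X) n j a b _ H (@grid_ccmpP X n.+1 (lift ord0 j) a b H)).
Qed.

(** A path of unit grids is the composite of its edges, so h sends it to the
    composite of their images. *)
Lemma omega_map_path m (p : paths X m) :
  h m.+1 (unit_grid m (paths X) p) =
  path_comp A m (path_map (psh_cmp h (unit_grid_hom X)) m p).
Proof.
case: hP => hs hc; case: p => [[x s] c].
elim: s x c => [|u s IH] x c.
  have -> : exist _ (x, [::]) c = path_refl X m x by apply: sval_inj_prop.
  rewrite -unit_grid_map; exact: (hs m ord0).
have [cx cs] := c.
(* The path splits as its first edge followed by the rest. *)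
pose e := path_edge X m u; pose p : paths X m := exist _ (_, s) cs.
have M : path_end X true m e = path_end X false m p by [].
pose w : paths2 X m := exist _ (e, p) M.
have -> : exist _ (x, u :: s) c = path_cat X m w.
  by apply: paths_ext => //=.
have W : grid_comp 0 (unit_grid m.+1 X u) (unit_grid m (paths X) p : grid m.+1 X)
    (unit_grid m (paths X) (path_cat X m w) : grid m.+1 X).
  exists (unit_grid m (paths2 X) w); rewrite !unit_grid_map; split=> //.
  exact/esym/unit_grid_map.
have H := grid_comp_match W.
rewrite -(@grid_ccmpE X m ord0 _ _ _ H W).
have H' : face A true ord0 (h m.+1 (unit_grid m.+1 X u)) =
          face A false ord0 (h m.+1 (unit_grid m (paths X) p)).
  by rewrite -!(hom_face h); congr (h m _).
rewrite (hc m ord0 _ _ H H'); move: H'; rewrite (IH _ cs) => H'.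
rewrite -comp0E; congr comp0; congr chain_comp.
exact: (hom_face (psh_cmp h (unit_grid_hom X)) true ord0 u).
Qed.
End Uniqueness.

(** Uniqueness in the universal property of free omega-categories. Grids in X
    of dimension n+1 are grids in [paths X] of dimension n, so by induction h
    is determined by its values on paths of unit grids. *)
Lemma omega_map_eval n (X : semicubical_set) (A : cubical_omega_category)
    (h : psh_hom (grids X) A) (t : grid n X) :
  @is_omega_map (grid_omega X) A h ->
  h n t = eval n A (grid_map n (psh_cmp h (unit_grid_hom X)) t).
Proof.
elim: n X A h t => [//|n IH] X A h t hP.
apply: etrans (IH (paths X) (omega_shift A) (shift_grids h) t
  (shift_grids_omega hP)) _.
congr (eval n (omega_shift A) _); apply/esym/grid_map_triangle => k p.
by apply/esym; apply: omega_map_path.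
Qed.

(** * The monad *)

Definition grids_functor : functor (Psh semicube) (Psh semicube).
Proof.
refine (@Functor (Psh semicube) (Psh semicube) grids (@grids_map) _ _).
- by move=> X; apply: psh_hom_ext => n t; apply: grid_map_id.
- by move=> X Y Z g f; apply: psh_hom_ext => n t; apply: grid_map_cmp.
Defined.

Definition grids_unit : nat_trans (functor_id (Psh semicube)) grids_functor.
Proof.
refine (@NatTrans _ _ (functor_id (Psh semicube)) grids_functor unit_grid_hom _).
by move=> X Y h; apply: psh_hom_ext => n x; apply/esym/unit_grid_map.
Defined.

Definition grids_mult :
  nat_trans (functor_comp grids_functor grids_functor) grids_functor.
Proof.
refine (@NatTrans _ _ (functor_comp grids_functor grids_functor) grids_functor
  (fun X => eval_hom (grid_omega X)) _).
move=> X Y h; apply: psh_hom_ext => n t.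
exact (esym (@eval_map n (grid_omega X) (grid_omega Y) (grids_map h) t
  (grids_map_omega h))).
Defined.

(** The monad of the free omega-category adjunction: the first unit law says
    that evaluation extends the identity, the second is [omega_map_eval] for the
    identity map, and associativity is the naturality of evaluation with
    respect to evaluation itself. *)
Definition grids_monad : monad (Psh semicube).
Proof.
refine (@Monad (Psh semicube) grids_functor grids_unit grids_mult _ _ _).
- move=> X; apply: psh_hom_ext => n t; exact: (@eval_unit_grid n (grid_omega X)).
- move=> X; apply: psh_hom_ext => n t.
  apply: etrans (esym (@omega_map_eval n X (grid_omega X) (psh_id (grids X)) t
    (is_omega_map_id (grid_omega X)))).
  by congr (eval n (grid_omega X) _); apply: grid_map_ext.
- move=> X; apply: psh_hom_ext => n t.
  exact (@eval_map n (grid_omega (grids X)) (grid_omega X) _ t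
    (eval_omega (grid_omega X))).
Defined.

(** * The unit and the multiplication are cartesian *)

Lemma cells_pullbackP (W X Y Z : semicubical_set) (p : psh_hom W X)
    (q : psh_hom W Y) (f : psh_hom X Z) (g : psh_hom Y Z) :
  cells_pullback p q f g -> @is_pullback (Psh semicube) W X Y Z p q f g.
Proof.
move=> pb; have [pq U] := pb; split; first exact: psh_hom_ext.
move=> V u v uv; have {}uv n x : f n (u n x) = g n (v n x).
  by have := congr1 (fun h : psh_hom V Z => h n x) uv.
have wP n x := cid (U n _ _ (uv n x)).
have w_nat m n (c : cube_hom m n) x :
    sval (wP m (act V c x)) = act W c (sval (wP n x)).
  have [[p1 q1] _] := svalP (wP m (act V c x)).
  have [[p2 q2] _] := svalP (wP n x).
  apply: (cells_pullback_inj pb).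
    by rewrite p1 [RHS](hom_act p) p2; apply: hom_act.
  by rewrite q1 [RHS](hom_act q) q2; apply: hom_act.
exists (@PshHom semicube V W (fun n x => sval (wP n x)) w_nat); split.
  by split; apply: psh_hom_ext => n x; have [[]] := svalP (wP n x).
move=> w' [e1 e2]; apply: psh_hom_ext => n x /=.
have [[p1 q1] _] := svalP (wP n x).
by apply: (cells_pullback_inj pb); rewrite ?p1 ?q1 -?e1 -?e2.
Qed.

Lemma path_edge_pullback (X Y : semicubical_set) (h : psh_hom X Y) :
  cells_pullback (shift_map h) (path_edge X) (path_edge Y) (path_map h).
Proof.
split=> [n x|n y p]; first exact/esym/path_map_edge.
case: p => [[x [|u [|v s]]] c] //= /(congr1 sval) [] // ey eu.
exists u; split=> [|u' [_ /(congr1 sval) [_ ->]]] //.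
by split=> //; have [? _] := c; apply: sval_inj_prop; congr pair.
Qed.

Lemma unit_grid_pullback (X Y : semicubical_set) (h : psh_hom X Y) :
  cells_pullback h (unit_grid_hom X) (unit_grid_hom Y) (grids_map h).
Proof.
split=> [n x|n]; first exact/esym/unit_grid_map.
elim: n X Y h => [|n IH] X Y h y t; first by move=> /= ->; exists t; split=> // x [].
move=> e; have [s [[s1 s2] sU]] := grid_map_pullback (path_edge_pullback h) e.
have [x [[x1 x2] xU]] := IH (shift X) (shift Y) (shift_map h) y s (esym s1).
exists x; split; first by split=> //; rewrite -s2 -x2.
move=> x' [x'1 x'2]; apply: xU; split=> //; apply/esym/sU; split=> //.
by rewrite unit_grid_map; congr (unit_grid n (shift Y) _).
Qed.

(** Unique lifting of decompositions along g, as for discrete Conduché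
    fibrations of categories. It is what makes a cell of A together with a
    decomposition of its image into a grid lift to a unique grid in A. *)
Record conduche (A B : cubical_omega_category) (g : psh_hom A B) : Prop := Conduche {
  conduche_omega : is_omega_map g;
  conduche_degen : forall n (i : 'I_n.+1) (a : A n.+1) (b : B n),
    g n.+1 a = degen B i b -> exists a', a = degen A i a';
  conduche_ccmp : forall n (j : 'I_n.+1) (a : A n.+1) (b1 b2 : B n.+1) H,
    g n.+1 a = ccmp B j b1 b2 H -> exists a1 a2 H',
    [/\ a = ccmp A j a1 a2 H', g n.+1 a1 = b1 & g n.+1 a2 = b2];
  conduche_uniq : forall n (j : 'I_n.+1) (a1 a2 a1' a2' : A n.+1) H H',
    ccmp A j a1 a2 H = ccmp A j a1' a2' H' ->
    g n.+1 a1 = g n.+1 a1' -> g n.+1 a2 = g n.+1 a2' -> a1 = a1' /\ a2 = a2' }.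

Lemma conduche_shift (A B : cubical_omega_category) (g : psh_hom A B) :
  conduche g -> @conduche (omega_shift A) (omega_shift B) (shift_map g).
Proof.
case=> gP gs gc gu; split.
- exact: shift_map_omega.
- by move=> n i; apply: (gs n.+1 (lift ord0 i)).
- by move=> n j; apply: (gc n.+1 (lift ord0 j)).
- by move=> n j; apply: (gu n.+1 (lift ord0 j)).
Qed.

Lemma grids_map_conduche (X Y : semicubical_set) (h : psh_hom X Y) :
  @conduche (grid_omega X) (grid_omega Y) (grids_map h).
Proof.
split.
- exact: grids_map_omega.
- move=> n i a b; apply: grid_degen_reflect; exact: ltn_ord i.
- move=> n j a b1 b2 H e.
  have [|a1 [a2 [Ha <- <-]]] := @grid_comp_reflect j n X Y h a b1 b2.
    by rewrite -[grid_map _ _ _]/(grids_map h n.+1 a) e; apply: grid_ccmpP.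
  exists a1, a2, (grid_comp_match Ha); split=> //.
  exact/esym/grid_ccmpE.
- move=> n j a1 a2 a1' a2' H H' e.
  apply: (grid_comp_reflect_uniq (grid_ccmpP H)).
  rewrite -[X in grid_comp _ _ _ X]/(ccmp (grid_omega X) j a1 a2 H) e.
  exact: (grid_ccmpP H').
Qed.

Lemma path_comp_pullback (A B : cubical_omega_category) (g : psh_hom A B) :
  conduche g ->
  cells_pullback (path_map g) (path_comp A) (path_comp B) (shift_map g).
Proof.
case=> gP gs gc gu; split=> [n p|n q a].
  exact/esym/path_comp_map.
have ex y t : chain y t -> forall a, chain_comp y t = g n.+1 a ->
    exists x s, [/\ chain x s, g n x = y, map (g n.+1) s = t & chain_comp x s = a].
  elim: t y => [|v t IH] y.
    move=> _ a' e; have [x ex] := gs _ _ _ _ (esym e); exists x, [::]; split=> //.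
    have := congr1 (face B false ord0) e.
    by rewrite face_degen_eq -(hom_face g) ex face_degen_eq.
  move=> [<- c] a'.
  have H : face B true ord0 v =
      face B false ord0 (chain_comp (face B true ord0 v) t).
    exact: esym (chain_comp_end false c).
  rewrite /= (comp0E H) => /esym /gc [a1 [a2 [H' [-> e1 e2]]]].
  have [x [s [cs ex es ea]]] := IH _ c a2 (esym e2).
  have ex1 : face A true ord0 a1 = x.
    by rewrite H' -ea; apply: (chain_comp_end false cs).
  exists (face A false ord0 a1), (a1 :: s); split=> //=.
  - by rewrite ex1.
  - by rewrite (hom_face g) e1.
  - by rewrite e1 es.
  - have H2 : face A true ord0 a1 =
        face A false ord0 (chain_comp (face A true ord0 a1) s) by rewrite ex1 ea
          -H' ex1.
    by rewrite (comp0E H2); apply: ccmp_congr; rewrite ?ex1 ?ea.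
have inj s x s' x' : chain x s -> chain x' s' ->
    map (g n.+1) s = map (g n.+1) s' -> chain_comp x s = chain_comp x' s' -> s = s'.
  elim: s x s' x' => [|u s IH] x [|u' s'] x' // [_ c] [_ c'] [e1 e2].
  have H : face A true ord0 u = face A false ord0 (chain_comp (face A true ord0 u) s).
    exact: esym (chain_comp_end false c).
  have H' : face A true ord0 u' =
      face A false ord0 (chain_comp (face A true ord0 u') s').
    exact: esym (chain_comp_end false c').
  rewrite /= (comp0E H) (comp0E H') => e.
  have E z r : chain z r -> g n.+1 (chain_comp z r) =
      chain_comp (g n z) (map (g n.+1) r).
    move=> cr; exact: (path_comp_map (exist _ (z, r) cr : paths A n) gP).
  have [||eu es] := gu _ _ _ _ _ _ _ _ e => //.
    by rewrite !E // e2 !(hom_face g) e1.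
  by rewrite eu (IH _ _ _ c c' e2 es).
case: q => [[y t] c] /= e; have [x [s [cs ex0 es ea]]] := ex y t c a e.
exists (exist _ (x, s) cs); split; first by split=> //; apply: paths_ext.
move=> [[x' s'] c'] [/(congr1 sval) [ex' es'] ea']; rewrite /= in ea'.
apply: paths_ext => /=; last by apply: (inj s x s' x'); rewrite // ?es ?ea.
have E := chain_comp_end false cs; have E' := chain_comp_end false c'.
by rewrite -[x]E -[x']E' ea ea'.
Qed.

(** Decompositions lift one direction at a time: first the outcome of composing
    the first direction is lifted by induction, then its edges. *)
Lemma eval_pullback (A B : cubical_omega_category) (g : psh_hom A B) :
  conduche g -> cells_pullback (grids_map g) (eval_hom A) (eval_hom B) g.
Proof.
move=> gP; split=> [n t|n]; first exact/esym/(eval_map t)/conduche_omega.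
elim: n A B g gP => [|n IH] A B g gP t a.
  by move=> /= ->; exists a; split=> // x [].
move=> e; have [r [[r1 r2] rU]] := IH _ _ _ (conduche_shift gP)
  (grid_map n (path_comp B) t) a e.
have [s [[s1 s2] sU]] := grid_map_pullback (path_comp_pullback gP) (esym r1).
exists s; split; first by split=> //; rewrite -r2 -s2.
move=> s' [s'1 s'2]; apply: sU; split=> //; apply/esym/rU; split=> //.
rewrite -s'1; apply: grid_map_square => k p; apply: path_comp_map.
exact: conduche_omega.
Qed.

Lemma grids_unit_cartesian : cartesian (munit grids_monad).
Proof. by move=> X Y h; apply/cells_pullbackP/unit_grid_pullback. Qed.

(** The multiplication is an evaluation, and maps of grids lift decompositions
    since they preserve lengths. *)
Lemma grids_mult_cartesian : cartesian (mmult grids_monad).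
Proof.
move=> X Y h; apply/cells_pullbackP.
exact (@eval_pullback (grid_omega X) (grid_omega Y) (grids_map h)
  (grids_map_conduche h)).
Qed.

(** * A criterion for familiality *)

Section FamilialCriterion.
Variable C : small_category.

Definition psh_one : presheaf C :=
  @Presheaf C (fun _ => unit) (fun a b f x => x) (fun a x => erefl)
    (fun a b c g f x => erefl).

Definition psh_bang (X : presheaf C) : psh_hom X psh_one :=
  @PshHom C X psh_one (fun a x => tt) (fun a b f x => erefl).

Variable F : functor (Psh C) (Psh C).

Definition psh_fmap (X Y : presheaf C) (h : psh_hom X Y) : psh_hom (F X) (F Y) :=
  @fmap (Psh C) (Psh C) F X Y h.

Lemma psh_fmap_cmp (X Y Z : presheaf C) (g : psh_hom Y Z) (f : psh_hom X Y) a
    (x : (F X : presheaf C) a) :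
  psh_fmap (psh_cmp g f) a x = psh_fmap g a (psh_fmap f a x).
Proof. by rewrite /psh_fmap (fmap_cmp F g f). Qed.

Lemma psh_fmap_id (X : presheaf C) a (x : (F X : presheaf C) a) :
  psh_fmap (psh_id X) a x = x.
Proof. by rewrite /psh_fmap (fmap_id F X). Qed.

Lemma psh_fmap_bang (X Y : presheaf C) (h : psh_hom X Y) a
    (x : (F X : presheaf C) a) :
  psh_fmap (psh_bang Y) a (psh_fmap h a x) = psh_fmap (psh_bang X) a x.
Proof. by rewrite -psh_fmap_cmp; congr (psh_fmap _ a x); apply: psh_hom_ext. Qed.

(** A generic element exhibits E as representing the part of F that lies over
    one element of F 1. A functor with enough generic elements is the coproduct
    of the functors that they represent, hence familial. *)
Definition generic (E : presheaf C) a (u : (F E : presheaf C) a) : Prop :=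
  forall (X : presheaf C) (x : (F X : presheaf C) a),
    psh_fmap (psh_bang X) a x = psh_fmap (psh_bang E) a u ->
    exists! h : psh_hom E X, psh_fmap h a u = x.

Hypothesis generics : forall a (t : (F psh_one : presheaf C) a),
  exists (E : presheaf C) (u : (F E : presheaf C) a),
    psh_fmap (psh_bang E) a u = t /\ generic u.

Let S : presheaf C := F psh_one.

Definition pick_generic a (t : S a) :
  {Eu : {E : presheaf C & (F E : presheaf C) a} |
    psh_fmap (psh_bang (tag Eu)) a (tagged Eu) = t /\ generic (tagged Eu)}.
Proof.
by apply: cid; have [E [u uP]] := generics t; exists (existT _ E u).
Qed.

Definition shape_ob (v : elements S) : presheaf C :=
  tag (sval (pick_generic (tagged v))).

Definition shape_gen (v : elements S) : (F (shape_ob v) : presheaf C) (tag v) :=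
  tagged (sval (pick_generic (tagged v))).

Lemma shape_genP v : psh_fmap (psh_bang (shape_ob v)) (tag v) (shape_gen v) =
    tagged v.
Proof. by have [] := svalP (pick_generic (tagged v)). Qed.

Lemma shape_generic v : generic (shape_gen v).
Proof. by have [] := svalP (pick_generic (tagged v)). Qed.

Definition shape_lift (v : elements S) (X : presheaf C)
    (x : (F X : presheaf C) (tag v))
      (e : psh_fmap (psh_bang X) (tag v) x = tagged v) :
  {h : psh_hom (shape_ob v) X | psh_fmap h (tag v) (shape_gen v) = x}.
Proof.
apply: cid; have [|h [hx _]] := @shape_generic v X x; last by exists h.
by rewrite e shape_genP.
Qed.

Lemma shape_inj (v : elements S) (X : presheaf C) (h h' : psh_hom (shape_ob v) X) :
  psh_fmap h (tag v) (shape_gen v) = psh_fmap h' (tag v) (shape_gen v) -> h = h'.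
Proof.
move=> e; have [|k [_ kU]] := @shape_generic v X (psh_fmap h (tag v) (shape_gen v)).
  by rewrite psh_fmap_bang.
by rewrite -(kU h) // -(kU h').
Qed.

Lemma shape_map_subproof (u v : elements S) (i : hom u v) :
  psh_fmap (psh_bang (shape_ob v)) (tag u)
    (act (F (shape_ob v) : presheaf C) (sval i) (shape_gen v)) = tagged u.
Proof. by rewrite phm_nat shape_genP; apply: svalP i. Qed.

Definition shape_map (u v : elements S) (i : hom u v) :
    psh_hom (shape_ob u) (shape_ob v) :=
  sval (shape_lift (shape_map_subproof i)).

Lemma shape_mapP (u v : elements S) (i : hom u v) :
  psh_fmap (shape_map i) (tag u) (shape_gen u) =
  act (F (shape_ob v) : presheaf C) (sval i) (shape_gen v).
Proof. exact: svalP (shape_lift _). Qed.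

Definition shape : functor (elements S) (Psh C).
Proof.
refine (@Functor (elements S) (Psh C) shape_ob shape_map _ _).
- move=> v; apply: shape_inj; rewrite shape_mapP.
  by rewrite [RHS]psh_fmap_id; apply: (@act_id C).
- move=> u v w j i; apply: shape_inj; rewrite shape_mapP.
  rewrite [RHS]psh_fmap_cmp shape_mapP phm_nat shape_mapP; exact: (@act_cmp C).
Defined.

Definition shape_cell (X : presheaf C) a (x : fam_cell shape X a) :
    (F X : presheaf C) a :=
  psh_fmap (tagged x) a (shape_gen (elt (tag x))).

Lemma shape_cell_nat (X : presheaf C) a b (i : shom a b) (x : fam_cell shape X b) :
  shape_cell (fam_act i x) = act (F X : presheaf C) i (shape_cell x).
Proof.
case: x => t f; rewrite /shape_cell /fam_act /= psh_fmap_cmp -phm_nat.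
congr (psh_fmap f a _); exact: (shape_mapP (elt_map i t)).
Qed.

Lemma shape_cell_map (X Y : presheaf C) (h : psh_hom X Y) a
    (x : fam_cell shape X a) :
  shape_cell (fam_map_cell h x) = psh_fmap h a (shape_cell x).
Proof. exact: psh_fmap_cmp. Qed.

Lemma shape_cell_inj (X : presheaf C) a (x y : fam_cell shape X a) :
  shape_cell x = shape_cell y -> x = y.
Proof.
case: x y => [t f] [s g] e.
have ts : t = s.
  have := congr1 (psh_fmap (psh_bang X) a) e.
  by rewrite !psh_fmap_bang !shape_genP.
by case: _ / ts g e => g e; congr existT; apply: (@shape_inj (elt t)).
Qed.

Lemma shape_cell_surj (X : presheaf C) a (x : (F X : presheaf C) a) :
  {y : fam_cell shape X a | shape_cell y = x}.
Proof.
have [h hx] := @shape_lift (elt (psh_fmap (psh_bang X) a x : S a)) X x erefl.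
by exists (existT _ (psh_fmap (psh_bang X) a x) h).
Qed.

(** The shapes are the elements of F 1; E is functorial on them because the
    restriction of a generic element classifies a unique map. *)
Lemma familial_of_generics : is_familial F.
Proof.
exists S, shape.
pose to X a (x : (F X : presheaf C) a) := sval (shape_cell_surj x).
have toK X a x : shape_cell (@to X a x) = x by apply: svalP (shape_cell_surj x).
have ofK X a x : @to X a (shape_cell x) = x by apply: shape_cell_inj.
have to_nat X a b (i : shom a b) x :
    @to X a (act (F X : presheaf C) i x) = fam_act i (@to X b x).
  by apply: shape_cell_inj; rewrite shape_cell_nat !toK.
pose toh X : psh_hom (F X) (fam_psh shape X) :=
  @PshHom C (F X) (fam_psh shape X) (@to X) (@to_nat X).
pose ofh X : psh_hom (fam_psh shape X) (F X) :=
  @PshHom C (fam_psh shape X) (F X) (@shape_cell X) (@shape_cell_nat X).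
have toh_nat (X Y : Psh C) (h : hom X Y) :
    psh_cmp (toh Y) (psh_fmap h) = psh_cmp (fam_map shape h) (toh X).
  apply: psh_hom_ext => a x; apply: shape_cell_inj.
  by rewrite [RHS]shape_cell_map !toK.
exists (@NatTrans _ _ F (familial_functor shape) toh toh_nat) => X.
by exists (ofh X); split; apply: psh_hom_ext => a x; [apply: toK|apply: ofK].
Qed.
End FamilialCriterion.

(** * Generic grids *)

Section PathShape.
Variables (E Z : semicubical_set) (z : psh_hom E (paths Z)).

Definition path_length n (y : E n) : nat := size (sval (z n y)).2.

Lemma path_length_act m n (c : cube_hom m n) y : path_length (act E c y) =
    path_length y.
Proof. by rewrite /path_length hom_act /= size_map. Qed.

Definition vertex n := {p : E n * nat | p.2 <= path_length p.1}.
Definition edge n := {p : E n * nat | p.2 < path_length p.1}.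

Definition edge_cell n : Type := if n is n'.+1 return Type then edge n' else void.

(** The left adjoint of [paths], relative to the lengths prescribed by z: each
    cell y of E is multiplied by a path whose length is that of z y. Its cells
    are pairs of a cell y and either a vertex of that path, in the dimension of
    y, or an edge, one dimension higher. *)
Definition cyl_cell n : Type := (vertex n + edge_cell n)%type.

Definition vertex_act m n (c : cube_hom m n) (p : vertex n) : vertex m.
Proof.
exists (act E c (sval p).1, (sval p).2).
by rewrite /= path_length_act; apply: svalP p.
Defined.

Definition edge_act m n (c : cube_hom m n) (p : edge n) : edge m.
Proof.
exists (act E c (sval p).1, (sval p).2).
by rewrite /= path_length_act; apply: svalP p.
Defined.

Definition edge_end n (e : bool) (p : edge n) : vertex n.
Proof.
exists ((sval p).1, e + (sval p).2).
by case: e; [exact: svalP p|exact: ltnW (svalP p)].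
Defined.

Definition edge_cell_act : forall m n, cube_hom m n.+1 -> edge n -> cyl_cell m :=
  @cube_hom_S (fun m n _ => edge n -> cyl_cell m)
    (fun m n e c p => inl (vertex_act c (edge_end e p)))
    (fun m n c p => inr (edge_act c p)).

Definition cyl_act m n (c : cube_hom m n) (x : cyl_cell n) : cyl_cell m :=
  match x with
  | inl p => inl (vertex_act c p)
  | inr p =>
    match n return cube_hom m n -> edge_cell n -> cyl_cell m with
    | 0 => fun _ => of_void _
    | n'.+1 => fun c p => edge_cell_act c p
    end c p
  end.

Lemma vertex_act_cmp m n p (d : cube_hom n p) (c : cube_hom m n) x :
  vertex_act (cube_cmp d c) x = vertex_act c (vertex_act d x).
Proof. by apply: val_inj; rewrite /= act_cube_cmp. Qed.

Lemma cyl_act_id n (x : cyl_cell n) : cyl_act (cube_id n) x = x.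
Proof.
case: x => [[[y i] p]|]; first by congr inl; apply: val_inj;
  rewrite /= (@act_id semicube).
by case: n => // n [[y i] p]; congr inr; apply: val_inj;
  rewrite /= (@act_id semicube).
Qed.

Lemma cyl_act_cmp m n p (d : cube_hom n p) (c : cube_hom m n) (x : cyl_cell p) :
  cyl_act (cube_cmp d c) x = cyl_act c (cyl_act d x).
Proof.
case: x => [x|]; first by congr inl; apply: vertex_act_cmp.
case: p d => // p d x; move: c x.
elim/cube_hom_S: d => [n' p' e d c x|n' p' d c]; first by congr inl;
  apply: vertex_act_cmp.
move: d; elim/cube_hom_S: c => [m' k e c d x|m' k c d x].
  by congr inl; apply: val_inj; rewrite /= act_cube_cmp.
by congr inr; apply: val_inj; rewrite /= act_cube_cmp.
Qed.

Definition cyl : semicubical_set :=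
  @Presheaf semicube cyl_cell cyl_act cyl_act_id cyl_act_cmp.

Lemma cyl_edge_end n e (p : edge n) :
  face cyl e ord0 (inr p : cyl n.+1) = inl (edge_end e p).
Proof. by rewrite /face coface0; congr inl; apply: val_inj;
  rewrite /= (@act_id semicube). Qed.

Definition cyl_edge n (y : E n) (i : 'I_(path_length y)) : cyl n.+1 :=
  inr (exist (fun p : E n * nat => p.2 < path_length p.1) (y, val i) (ltn_ord i)).

Definition cyl_vertex n (y : E n) i (le_i : i <= path_length y) : cyl n :=
  inl (exist (fun p : E n * nat => p.2 <= path_length p.1) (y, i) le_i).

Lemma cyl_vertex_S n (y : E n) i (lt_i : i < path_length y) :
  cyl_vertex lt_i = face cyl true ord0 (cyl_edge (Ordinal lt_i)).
Proof. by rewrite cyl_edge_end; congr inl; apply: val_inj. Qed.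

Lemma nth_enum_map (T : Type) k (f : 'I_k -> T) x0 i (lt_i : i < k) :
  nth x0 (map f (enum 'I_k)) i = f (Ordinal lt_i).
Proof.
rewrite (nth_map (Ordinal lt_i)) ?size_enum_ord //; congr f; apply: val_inj.
exact: nth_enum_ord.
Qed.

(** The default element [u0] is quantified over, as X may have no cells in
    dimension n+1 when s is empty. *)
Lemma chain_nthP (X : semicubical_set) n (x : X n) s :
  chain x s <-> forall u0 i, i < size s ->
    face X false ord0 (nth u0 s i) = nth x (x :: map (face X true ord0) s) i.
Proof.
have D (y x' : X n) t i : i <= size t ->
    nth y (y :: map (face X true ord0) t) i =
      nth x' (y :: map (face X true ord0) t) i.
  by move=> le_i; apply: set_nth_default; rewrite /= size_map.
split.
  elim: s x => // u s IH x [ux c] u0 [|i] //= lt_i.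
  by rewrite (IH _ c) // (D _ x) 1?ltnW.
elim: s x => // u s IH x H; split; first exact: (H u 0).
by apply: IH => u0 i lt_i; rewrite (D _ x) 1?ltnW //; apply: (H u0 i.+1).
Qed.

Lemma cyl_path_chain n (y : E n) :
  chain (cyl_vertex (leq0n (path_length y)))
    (map (@cyl_edge n y) (enum 'I_(path_length y))).
Proof.
apply/chain_nthP => u0 i; rewrite size_map size_enum_ord => lt_i.
rewrite nth_enum_map cyl_edge_end; case: i lt_i => [|i] lt_i.
  by congr inl; apply: val_inj.
rewrite /= -map_comp (nth_enum_map _ _ (ltnW lt_i)) [RHS]cyl_edge_end.
by congr inl; apply: val_inj.
Qed.

Definition cyl_path_cell n (y : E n) : paths cyl n :=
  exist (fun p : cyl n * seq (cyl n.+1) => chain p.1 p.2) (_, _)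
    (cyl_path_chain y).

Lemma eq_map_enum (T : Type) k l (f : 'I_k -> T) (g : 'I_l -> T) : k = l ->
  (forall (i : 'I_k) (j : 'I_l), i = j :> nat -> f i = g j) ->
  map f (enum 'I_k) = map g (enum 'I_l).
Proof. by move=> e; subst l => fg; apply: eq_map => i; exact: fg. Qed.

Lemma cyl_path_nat m n (c : cube_hom m n) (y : E n) :
  cyl_path_cell (act E c y) = act (paths cyl) c (cyl_path_cell y).
Proof.
apply: paths_ext => /=; first by congr inl; apply: val_inj.
rewrite -map_comp; apply: eq_map_enum; first exact: path_length_act.
by move=> i j ij; congr inr; apply: val_inj; rewrite /= ij.
Qed.

Definition cyl_path : psh_hom E (paths cyl) :=
  @PshHom semicube E (paths cyl) cyl_path_cell cyl_path_nat.

(** The edges of [cyl] are the edges of the paths of [cyl_path]; its vertices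
    are their starts and the ends of their edges. *)
Lemma cyl_hom_inj (X : semicubical_set) (h h' : psh_hom cyl X) :
  (forall n y, path_map h n (cyl_path n y) = path_map h' n (cyl_path n y)) ->
  h = h'.
Proof.
move=> H.
have He n y i : h n.+1 (@cyl_edge n y i) = h' n.+1 (@cyl_edge n y i).
  have : map (h n.+1) (map (@cyl_edge n y) (enum 'I_(path_length y))) =
      map (h' n.+1) (map (@cyl_edge n y) (enum 'I_(path_length y))).
    exact (congr1 (fun p : paths X n => (sval p).2) (H n y)).
  rewrite -map_comp -[RHS]map_comp => /eq_in_map /(_ i); apply.
  by rewrite mem_enum.
apply: psh_hom_ext => n [[[y i] le_i]|]; last first.
  case: n => // n [[y i] lt_i].
  suff -> : inr (exist _ (y, i) lt_i) = cyl_edge (Ordinal lt_i) by apply: He.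
  by congr inr; apply: val_inj.
case: i le_i => [|i] le_i.
  have /= := congr1 (fun p : paths X n => (sval p).1) (H n y).
  by rewrite /cyl_vertex (bool_irrelevance le_i (leq0n (path_length y))).
by rewrite -/(cyl_vertex le_i) cyl_vertex_S !hom_face He.
Qed.

Section CylHom.
Variables (X : semicubical_set) (k : psh_hom E (paths X)).
Hypothesis k_len : forall n y, size (sval (k n y)).2 = path_length y.

Definition vertex_hom n (p : vertex n) : X n :=
  let q := sval (k n (sval p).1) in
  nth q.1 (q.1 :: map (face X true ord0) q.2) (sval p).2.

Definition edge_hom n (p : edge n) : X n.+1 :=
  tnth (in_tuple (sval (k n (sval p).1)).2)
    (Ordinal (eq_ind_r (fun m => (sval p).2 < m) (svalP p) (k_len (sval p).1))).

Definition cyl_hom_cell n (x : cyl n) : X n :=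
  match x with
  | inl p => vertex_hom p
  | inr p =>
    match n return edge_cell n -> X n with
    | 0 => of_void _
    | n'.+1 => @edge_hom n'
    end p
  end.

Lemma vertex_hom_act m n (c : cube_hom m n) (p : vertex n) :
  vertex_hom (vertex_act c p) = act X c (vertex_hom p).
Proof.
case: p => [[y i] le_i]; rewrite /vertex_hom /= hom_act /=.
rewrite -(nth_map _ (act X c (sval (k n y)).1)) /=; last by rewrite /= size_map k_len.
congr (nth _ (_ :: _) _); rewrite -!map_comp; apply: eq_map => u.
exact: face0_wire.
Qed.

Lemma edge_hom_act m n (c : cube_hom m n) (p : edge n) :
  edge_hom (edge_act c p) = act X (cube_wire c) (edge_hom p).
Proof.
have u0 := edge_hom p; case: p => [[y i] lt_i]; rewrite /edge_hom.
rewrite !(tnth_nth (act X (cube_wire c) u0)) /= hom_act /= (nth_map u0) ?k_len //.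
by congr (act X _ _); apply: set_nth_default; rewrite k_len.
Qed.

Lemma edge_hom_end n e (p : edge n) :
  face X e ord0 (edge_hom p) = vertex_hom (edge_end e p).
Proof.
have u0 := edge_hom p; case: p => [[y i] lt_i]; rewrite /edge_hom /vertex_hom /=.
rewrite (tnth_nth u0) /=; case: e => /=; last first.
  by have /chain_nthP -> // := svalP (k n y); rewrite k_len.
by rewrite (nth_map u0) // k_len.
Qed.

Lemma cyl_hom_nat m n (c : cube_hom m n) (x : cyl n) :
  cyl_hom_cell (act cyl c x) = act X c (cyl_hom_cell x).
Proof.
case: x => [p|]; first exact: vertex_hom_act.
case: n c => // n c p; move: p; elim/cube_hom_S: c => [m' n' e c p|m' n' c p].
  rewrite [RHS]act_cube_face; apply: etrans (vertex_hom_act c (edge_end e p)) _.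
  by congr (act X c _); apply/esym/edge_hom_end.
exact: edge_hom_act.
Qed.

Definition cyl_hom : psh_hom cyl X :=
  @PshHom semicube cyl X cyl_hom_cell cyl_hom_nat.

Lemma cyl_homP n y : path_map cyl_hom n (cyl_path n y) = k n y.
Proof.
apply: paths_ext; first by [].
rewrite -[LHS]/(map (cyl_hom n.+1)
  (map (@cyl_edge n y) (enum 'I_(path_length y)))) -map_comp.
rewrite -[RHS](map_tnth_enum (in_tuple (sval (k n y)).2)).
by apply: eq_map_enum => // i j ij; congr tnth; apply: val_inj.
Qed.
End CylHom.

(** The extension of k sends the vertices and edges of [cyl] to those of the
    paths that k assigns; it is unique by [cyl_hom_inj]. *)
Lemma cyl_generic :
  exists (z1 : psh_hom cyl Z), (forall n y, path_map z1 n (cyl_path n y) = z n y) /\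
  forall (X : semicubical_set) (g : psh_hom X Z) (k : psh_hom E (paths X)),
    psh_cmp (path_map g) k = z ->
    exists! h : psh_hom cyl X,
      psh_cmp (path_map h) cyl_path = k /\ psh_cmp g h = z1.
Proof.
pose z1 := cyl_hom (k := z) (fun n y => erefl).
have z1P n y : path_map z1 n (cyl_path n y) = z n y by apply: cyl_homP.
exists z1; split=> // X g k gk.
have k_len n y : size (sval (k n y)).2 = path_length y.
  by rewrite /path_length -gk /= size_map.
have hP := cyl_homP k_len; exists (cyl_hom k_len); split.
  split; first exact: psh_hom_ext.
  apply: cyl_hom_inj => n y; rewrite z1P path_map_cmp.
  have <- : path_map g n (k n y) = z n y by rewrite -gk.
  exact (congr1 (path_map g n) (hP n y)).
move=> h' [e _]; apply: cyl_hom_inj => n y; rewrite hP -e //.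
Qed.
End PathShape.

(** The Yoneda lemma, stated as the existence of a generic cell. *)
Lemma representable_generic (n : nat) : exists Y : semicubical_set, exists u : Y n,
  forall (X : semicubical_set) (x : X n), exists! h : psh_hom Y X, h n u = x.
Proof.
pose Y : semicubical_set := @Presheaf semicube (fun m => cube_hom m n)
  (fun m k c d => cube_cmp d c) (fun m d => cube_cmp_idr d)
  (fun m k p c b d => esym (cube_cmp_assoc d c b)).
exists Y, (cube_id n) => X x.
exists (@PshHom semicube Y X (fun m d => act X d x)
  (fun m k c d => act_cube_cmp d c x)).
split=> [|h <-]; first exact: (@act_id semicube).
apply: psh_hom_ext => m d /=; rewrite -hom_act /=; congr (h m _).
exact: cube_cmp_idl.
Qed.

(** The statement is relative to a base Z, not only to the terminal object, so
    that it can be applied by induction to the base [paths Z]; the generic grid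
    of paths so obtained is then made one of cells by [cyl_generic]. *)
Lemma grid_generic n (Z : semicubical_set) (t : grid n Z) :
  exists (E : semicubical_set) (u : grid n E) (z : psh_hom E Z),
    grid_map n z u = t /\
    forall (X : semicubical_set) (g : psh_hom X Z) (x : grid n X),
      grid_map n g x = t ->
      exists! h : psh_hom E X, grid_map n h u = x /\ psh_cmp g h = z.
Proof.
elim: n Z t => [|n IH] Z t.
  have [Y [u Yu]] := representable_generic 0; have [z [zu zU]] := Yu Z t.
  exists Y, u, z; split=> // X g x gx; have [h [hu hU]] := Yu X x.
  exists h; split; last by move=> h' [/hU].
  by split=> //; apply/esym/zU; rewrite /= hu.
have [E [u [z [zu zU]]]] := IH (paths Z) t.
have [z1 [z1P z1U]] := cyl_generic z.
exists (cyl z), (grid_map n (cyl_path z) u), z1; split.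
  by rewrite -zu; apply: (@grid_map_triangle n _ _ _ (cyl_path z) (path_map z1)).
move=> X g x gx.
have [k [[ku gk] kU]] := zU (paths X) (path_map g) x gx.
have [h [[hk gh] hU]] := z1U X g k gk.
exists h; split.
  split=> //; rewrite -ku -hk.
  exact (esym (grid_map_cmp (path_map h) (cyl_path z) u)).
move=> h' [h'u gh']; apply: hU; split=> //; apply/esym/kU; split.
  by rewrite grid_map_cmp; exact: h'u.
by apply: psh_hom_ext => m y; rewrite -z1P -gh' path_map_cmp.
Qed.

(** Over the terminal object a grid is its sequence of lengths, and the generic
    grid with these lengths is the tensor product of paths. *)
Lemma grids_familial : is_familial grids_functor.
Proof.
apply: familial_of_generics => n t.
have [E [u [z [zu zU]]]] := @grid_generic n (psh_one semicube) t.
have one (X : semicubical_set) (h h' : psh_hom X (psh_one semicube)) : h = h'.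
  by apply: psh_hom_ext => m x; case: (h m x) (h' m x) => [] [].
exists E, u; split; first by rewrite (one E (psh_bang E) z).
move=> X x; rewrite (one E (psh_bang E) z) => e.
have [|h [[hu _] hU]] := zU X (psh_bang X) x; first by rewrite -zu.
by exists h; split=> // h' h'u; apply: hU; split=> //; apply: one.
Qed.

(** * Algebras and omega-categories *)

Section Matching.
Variable A : cubical_omega_category.

Lemma match_face n e (i j : 'I_n.+2) (j' : 'I_n.+1) (x y : A n.+2) :
  (i < j /\ j = j'.+1 :> nat) \/ (j < i /\ j = j' :> nat) ->
  face A true j x = face A false j y ->
  face A true j' (face A e i x) = face A false j' (face A e i y).
Proof.
case=> [] [lt ej] H.
  have lt_i : i < n.+1 by apply: leq_trans lt _; rewrite -ltnS.
  have E b z : face A e (Ordinal lt_i) (face A b j z) = face A b j' (face A e i z).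
    exact: face_face.
  by rewrite -!E H.
case: i lt => [[|i] lt_i] // lt.
have E b z : face A b j' (face A e (Ordinal lt_i) z) =
    face A e (Ordinal (lt_i : i < n.+1)) (face A b j z).
  by apply: face_face => //=; rewrite -ej.
by rewrite !E H.
Qed.

Lemma match_ccmp n (i j : 'I_n.+1) (x y z w : A n.+1) Hxy Hzw : i != j ->
  face A true j x = face A false j z -> face A true j y = face A false j w ->
  face A true j (ccmp A i x y Hxy) = face A false j (ccmp A i z w Hzw).
Proof.
case: n i j x y z w Hxy Hzw => [|n] i j x y z w Hxy Hzw.
  by rewrite [i]ord1 [j]ord1.
rewrite neq_ltn => /orP [lt_ij|lt_ji] Hxz Hyw.
- have lt_i : i < n.+1 by exact: leq_trans lt_ij (ltn_ord j : j <= n.+1).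
  have M b u v (H : face A true i u = face A false i v) :
      face A true (Ordinal lt_i) (face A b j u) =
        face A false (Ordinal lt_i) (face A b j v).
    exact: (@match_face n b j i (Ordinal lt_i) u v (or_intror (conj lt_ij erefl)) H).
  rewrite (@face_ccmp_gt A n true j i _ x y Hxy (M true _ _ Hxy) lt_ij erefl).
  rewrite (@face_ccmp_gt A n false j i _ z w Hzw (M false _ _ Hzw) lt_ij erefl).
  exact: ccmp_congr.
- case: i lt_ji Hxy Hzw => [[|i] lt_i] // lt_ji Hxy Hzw.
  have M b u v (H : face A true (Ordinal lt_i) u = face A false (Ordinal lt_i) v) :
      face A true (Ordinal (lt_i : i < n.+1)) (face A b j u) =
      face A false (Ordinal (lt_i : i < n.+1)) (face A b j v).
    exact: (@match_face n b j (Ordinal lt_i) (Ordinal (lt_i : i < n.+1)) u v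
      (or_introl (conj lt_ji erefl)) H).
  rewrite (@face_ccmp_lt A n true j _ _ x y Hxy (M true _ _ Hxy) lt_ji erefl).
  rewrite (@face_ccmp_lt A n false j _ _ z w Hzw (M false _ _ Hzw) lt_ji erefl).
  exact: ccmp_congr.
Qed.

Lemma match_degen n (i j' : 'I_n.+2) (j : 'I_n.+1) (x y : A n.+1) :
  (i <= j /\ j' = j.+1 :> nat) \/ (j < i /\ j' = j :> nat) ->
  face A true j x = face A false j y ->
  face A true j' (degen A i x) = face A false j' (degen A i y).
Proof.
case=> [] [le ej] H.
  have lt_i : i < n.+1 by apply: leq_ltn_trans le _.
  have E b z : face A b j' (degen A i z) = degen A (Ordinal lt_i) (face A b j z).
    by apply: face_degen_gt; rewrite ?ej.
  by rewrite !E H.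
case: i le => [[|i] lt_i] // le.
have E b z : face A b j' (degen A (Ordinal lt_i) z) =
    degen A (Ordinal (lt_i : i < n.+1)) (face A b j z).
  by apply: face_degen_lt; rewrite /= ?ej.
by rewrite !E H.
Qed.
End Matching.

Section AlgebraOmega.
Variable M : algebra grids_monad.
Let X : semicubical_set := alg_ob M.
Let a : psh_hom (grids X) X := alg_str M.
Let G := grid_omega X.

Lemma alg_unit_grid n (x : X n) : a n (unit_grid n X x) = x.
Proof. exact: (congr1 (fun h : psh_hom X X => h n x) (alg_unit M)). Qed.

Lemma alg_eval n (t : grid n (grids X)) :
  a n (eval n G t) = a n (grid_map n a t).
Proof.
exact: (congr1 (fun h : psh_hom (grids (grids X)) X => h n t) (alg_mult M)).
Qed.

Definition alg_degen n (i : 'I_n.+1) (x : X n) : X n.+1 :=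
  a n.+1 (degen G i (unit_grid n X x)).

(** The algebra structure is a map for the operations transported along it from
    the free omega-category: both sides come from one degenerate grid of grids,
    evaluated inside or outside by the associativity law of the algebra. *)
Lemma alg_degenE n (i : 'I_n.+1) (t : G n) :
  alg_degen i (a n t) = a n.+1 (degen G i t).
Proof.
transitivity (a n.+1 (eval n.+1 G (grid_degen i (unit_grid n (grids X) t)))).
  rewrite alg_eval /alg_degen; congr (a n.+1 _).
  by rewrite -[LHS]/(grid_degen i _) grid_degen_map unit_grid_map.
by rewrite (@eval_degen n G) (@eval_unit_grid n G).
Qed.

Lemma unit_grid_match n (j : 'I_n.+1) (Y : semicubical_set) (x y : Y n.+1) :
  face Y true j x = face Y false j y ->
  face (grids Y) true j (unit_grid n.+1 Y x) =
    face (grids Y) false j (unit_grid n.+1 Y y).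
Proof. by rewrite -!(hom_face (unit_grid_hom Y)) /= => ->. Qed.

Definition alg_ccmp n (j : 'I_n.+1) (x y : X n.+1)
    (H : face X true j x = face X false j y) : X n.+1 :=
  a n.+1 (ccmp G j (unit_grid n.+1 X x) (unit_grid n.+1 X y) (unit_grid_match H)).

Lemma alg_ccmpE n (j : 'I_n.+1) (s t : G n.+1) Hst x y
    (H : face X true j x = face X false j y) :
  a n.+1 s = x -> a n.+1 t = y -> alg_ccmp H = a n.+1 (ccmp G j s t Hst).
Proof.
move=> ex ey; subst x y.
have C := grid_ccmpP (unit_grid_match (Y := grids X) Hst).
have [H2 e2] := @eval_comp j n G j _ _ _ erefl C.
transitivity (a n.+1 (eval n.+1 G (grid_ccmp (unit_grid_match (Y := grids X) Hst)))).
  rewrite alg_eval /alg_ccmp; congr (a n.+1 _); apply: grid_ccmpE.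
  by have := grid_comp_map a C; rewrite !unit_grid_map.
rewrite -e2; congr (a n.+1 _).
exact (@ccmp_congr G n j _ _ s t H2 Hst (@eval_unit_grid n.+1 G s)
  (@eval_unit_grid n.+1 G t)).
Qed.

Lemma alg_face n e (i : 'I_n.+1) (t : G n.+1) :
  face X e i (a n.+1 t) = a n (face G e i t).
Proof. exact/esym/hom_face. Qed.

Lemma unit_grid_face n e (i : 'I_n.+1) (x : X n.+1) :
  unit_grid n X (face X e i x) = face G e i (unit_grid n.+1 X x).
Proof. exact: (hom_face (unit_grid_hom X)). Qed.

(** Every law of a cubical omega-category transfers from grids, since cells of
    X are images of unit grids, composable ones of composable ones, and the
    algebra structure preserves the operations. *)
Definition alg_cubical : cubical_set.
Proof.
refine (@CubicalSet X alg_degen _ _ _ _).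
- move=> n i j i' j' x le_ij ei' ej'; rewrite [alg_degen j x]/alg_degen.
  rewrite [alg_degen i x]/alg_degen !alg_degenE; congr (a n.+2 _).
  exact: (degen_degen (c := G)).
- move=> n e i j i' j' x lt_ij ei' ej; rewrite /alg_degen alg_face unit_grid_face.
  by congr (a n.+1 _); apply: (face_degen_lt (c := G)).
- move=> n e i x; rewrite /alg_degen alg_face.
  rewrite (face_degen_eq (c := G)); exact: alg_unit_grid.
- move=> n e i j i' j' x lt_ji ei ej'; rewrite /alg_degen alg_face unit_grid_face.
  by congr (a n.+1 _); apply: (face_degen_gt (c := G)).
Defined.

Definition alg_omega : cubical_omega_category.
Proof.
refine (@CubicalOmegaCategory alg_cubical alg_ccmp _ _ _ _ _ _ _ _ _ _).
- move=> n j x y H; rewrite /alg_ccmp [LHS]alg_face (face_ccmp_src (c0 := G)).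
  by rewrite -unit_grid_face; apply: alg_unit_grid.
- move=> n j x y H; rewrite /alg_ccmp [LHS]alg_face (face_ccmp_tgt (c0 := G)).
  by rewrite -unit_grid_face; apply: alg_unit_grid.
- move=> n e i j j' x y H H' lt_ij ej.
  have M1 : face G true j' (face G e i (unit_grid n.+2 X x)) =
            face G false j' (face G e i (unit_grid n.+2 X y)).
    by have := unit_grid_match H'; rewrite !(@unit_grid_face n.+1 e i).
  apply: etrans (alg_face e i _) _; congr (a n.+1 _).
  apply: etrans (face_ccmp_lt (c0 := G) _ M1 lt_ij ej) _.
  exact: (@ccmp_congr G n j' _ _ _ _ M1 (unit_grid_match H')
    (esym (unit_grid_face e i x))
    (esym (unit_grid_face e i y))).
- move=> n e i j j' x y H H' lt_ji ej'.
  have M1 : face G true j' (face G e i (unit_grid n.+2 X x)) =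
            face G false j' (face G e i (unit_grid n.+2 X y)).
    by have := unit_grid_match H'; rewrite !(@unit_grid_face n.+1 e i).
  apply: etrans (alg_face e i _) _; congr (a n.+1 _).
  apply: etrans (face_ccmp_gt (c0 := G) _ M1 lt_ji ej') _.
  exact: (@ccmp_congr G n j' _ _ _ _ M1 (unit_grid_match H')
    (esym (unit_grid_face e i x))
    (esym (unit_grid_face e i y))).
- move=> n j x y z H1 H2 H3 H4.
  have M1 : face G true j (ccmp G j (unit_grid n.+1 X x) (unit_grid n.+1 X y)
    (unit_grid_match H1)) =
            face G false j (unit_grid n.+1 X z).
    by rewrite (face_ccmp_tgt (c0 := G)); exact (unit_grid_match H3).
  have M2 : face G true j (unit_grid n.+1 X x) =
      face G false j (ccmp G j (unit_grid n.+1 X y) (unit_grid n.+1 X z)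
        (unit_grid_match H3)).
    by rewrite (face_ccmp_src (c0 := G)); exact (unit_grid_match H1).
  rewrite (alg_ccmpE M1 _ erefl (alg_unit_grid z))
    (alg_ccmpE M2 _ (alg_unit_grid x) erefl).
  congr (a n.+1 _); exact: (ccmp_assoc (c0 := G)).
- move=> n j x H.
  have M1 : face G true j (degen G j (face G false j (unit_grid n.+1 X x))) =
            face G false j (unit_grid n.+1 X x).
    by rewrite (face_degen_eq (c := G)).
  rewrite (alg_ccmpE M1) ?alg_unit_grid //.
    by rewrite (ccmp_unitl (c0 := G)); apply: alg_unit_grid.
  by rewrite -unit_grid_face.
- move=> n j x H.
  have M1 : face G true j (unit_grid n.+1 X x) =
            face G false j (degen G j (face G true j (unit_grid n.+1 X x))).
    by rewrite (face_degen_eq (c := G)).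
  rewrite (alg_ccmpE M1) ?alg_unit_grid //.
    by rewrite (ccmp_unitr (c0 := G)); apply: alg_unit_grid.
  by rewrite -unit_grid_face.
- move=> n i j x y z w H1 H2 H3 H4 H5 H6 ne_ij.
  have M1 : face G true j (ccmp G i (unit_grid n.+1 X x) (unit_grid n.+1 X y)
    (unit_grid_match H1)) =
            face G false j (ccmp G i (unit_grid n.+1 X z) (unit_grid n.+1 X w)
              (unit_grid_match H2)).
    by apply: match_ccmp; rewrite // (unit_grid_match H4, unit_grid_match H5).
  have M2 : face G true i (ccmp G j (unit_grid n.+1 X x) (unit_grid n.+1 X z)
    (unit_grid_match H4)) =
            face G false i (ccmp G j (unit_grid n.+1 X y) (unit_grid n.+1 X w)
              (unit_grid_match H5)).
    by apply: match_ccmp; rewrite 1?eq_sym //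
      (unit_grid_match H1, unit_grid_match H2).
  rewrite (alg_ccmpE M1 _ erefl erefl) (alg_ccmpE M2 _ erefl erefl).
  by congr (a n.+1 _); apply: (ccmp_interchange (c0 := G)).
- move=> n j i j' x y H H' le_ij ej'.
  have M1 : face G true j' (degen G i (unit_grid n.+1 X x)) =
            face G false j' (degen G i (unit_grid n.+1 X y)).
    exact: (@match_degen G n i j' j _ _ (or_introl (conj le_ij ej'))
      (unit_grid_match H)).
  rewrite (alg_ccmpE M1 _ erefl erefl) [LHS]alg_degenE; congr (a n.+2 _).
  exact: (degen_ccmp_le (c0 := G)).
- move=> n j i j' x y H H' lt_ji ej'.
  have M1 : face G true j' (degen G i (unit_grid n.+1 X x)) =
            face G false j' (degen G i (unit_grid n.+1 X y)).
    exact: (@match_degen G n i j' j _ _ (or_intror (conj lt_ji ej'))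
      (unit_grid_match H)).
  rewrite (alg_ccmpE M1 _ erefl erefl) [LHS]alg_degenE; congr (a n.+2 _).
  exact: (degen_ccmp_gt (c0 := G)).
Defined.

Lemma alg_str_omega : @is_omega_map G alg_omega a.
Proof.
split=> [n i t|n j s t H H']; first exact/esym/alg_degenE.
exact/esym/alg_ccmpE.
Qed.

(** By uniqueness of the extension of the identity of X to grids. *)
Lemma alg_str_eval : a = eval_hom alg_omega.
Proof.
apply: psh_hom_ext => n t.
rewrite (@omega_map_eval n X alg_omega a t alg_str_omega).
congr (eval n alg_omega _); rewrite -[RHS]grid_map_id; apply: grid_map_ext => m x.
exact: alg_unit_grid.
Qed.
End AlgebraOmega.

Lemma alg_hom_omega (M N : algebra grids_monad) (f : alg_hom M N) :
  @is_omega_map (alg_omega M) (alg_omega N) (sval f).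
Proof.
case: f => f fP; have fE n t : f n (alg_str M n t) = alg_str N n (grid_map n f t).
  exact: (congr1 (fun h : psh_hom (grids (alg_ob M)) (alg_ob N) => h n t) fP).
split=> [n i x|n j x y H H'] /=.
  by rewrite /alg_degen fE [grid_map _ _ _]grid_degen_map unit_grid_map.
rewrite /alg_ccmp fE; congr (alg_str N n.+1 _); apply/esym/grid_ccmpE.
have := grid_comp_map f (grid_ccmpP (unit_grid_match H)).
by rewrite !unit_grid_map.
Qed.

Definition omega_of_alg : functor (alg_cat grids_monad) omega_cat.
Proof.
refine (@Functor (alg_cat grids_monad) omega_cat alg_omega
  (fun M N f => exist _ (sval f) (alg_hom_omega f)) _ _).
- by move=> M; apply: sval_inj_prop.
- by move=> M N P g f; apply: sval_inj_prop.
Defined.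

Definition alg_of_omega_ob (A : cubical_omega_category) : algebra grids_monad.
Proof.
refine (@Algebra _ grids_monad (cset (cocset A)) (eval_hom A) _ _).
- by apply: psh_hom_ext => n x; apply: eval_unit_grid.
- apply: psh_hom_ext => n t.
  exact (@eval_map n (grid_omega A) A (eval_hom A) t (eval_omega A)).
Defined.

Lemma omega_map_alg (A B : cubical_omega_category) (f : omega_map A B) :
  @is_alg_hom _ grids_monad (alg_of_omega_ob A) (alg_of_omega_ob B) (sval f).
Proof.
apply: psh_hom_ext => n t; exact (@eval_map n A B (sval f) t (svalP f)).
Qed.

Definition alg_of_omega : functor omega_cat (alg_cat grids_monad).
Proof.
refine (@Functor omega_cat (alg_cat grids_monad) alg_of_omega_ob
  (fun A B f => exist _ (sval f) (omega_map_alg f)) _ _).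
- by move=> A; apply: sval_inj_prop.
- by move=> A B D g f; apply: sval_inj_prop.
Defined.

Lemma omega_of_alg_of_omega (A : cubical_omega_category) :
  @is_omega_map (alg_omega (alg_of_omega_ob A)) A (psh_id A) /\
  @is_omega_map A (alg_omega (alg_of_omega_ob A)) (psh_id A).
Proof.
have D n (i : 'I_n.+1) (x : A n) :
    degen (alg_omega (alg_of_omega_ob A)) i x = degen A i x.
  by apply: etrans (eval_degen i (unit_grid n A x)) _; rewrite eval_unit_grid.
have S n (j : 'I_n.+1) (x y : A n.+1) H H' :
    ccmp (alg_omega (alg_of_omega_ob A)) j x y H = ccmp A j x y H'.
  have [H2 e] := @eval_comp j n A j _ _ _ erefl (grid_ccmpP (unit_grid_match H)).
  by apply: etrans (esym e) _; apply: ccmp_congr; apply: eval_unit_grid.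
split; split=> [n i x|n j x y H H'].
- exact: D.
- exact: S.
- exact/esym/D.
- exact/esym/S.
Qed.

(** Both round trips keep the underlying semicubical set: the structure returns
    by [omega_of_alg_of_omega] and by [alg_str_eval]. *)
Lemma alg_of_omega_equivalence : is_equivalence alg_of_omega.
Proof.
exists omega_of_alg; split.
- pose to A : omega_map (alg_omega (alg_of_omega_ob A)) A :=
    exist _ (psh_id A) (omega_of_alg_of_omega A).1.
  have to_nat (A B : omega_cat) (f : hom A B) :
      @cmp omega_cat _ _ _ (to B) (fmap (functor_comp omega_of_alg alg_of_omega) f) =
      @cmp omega_cat _ _ _ f (to A).
    by apply: sval_inj_prop; apply: psh_hom_ext.
  exists (@NatTrans _ _ (functor_comp omega_of_alg alg_of_omega)
    (functor_id omega_cat)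
    to to_nat) => A.
  exists (exist _ (psh_id A) (omega_of_alg_of_omega A).2).
  by split; apply: sval_inj_prop; apply: psh_hom_ext.
- have idP (M : algebra grids_monad) :
      @is_alg_hom _ grids_monad (alg_of_omega_ob (alg_omega M)) M
        (psh_id (alg_ob M)) /\
      @is_alg_hom _ grids_monad M (alg_of_omega_ob (alg_omega M)) (psh_id (alg_ob M)).
    have E n (t : grid n (alg_ob M)) : alg_str M n t = eval n (alg_omega M) t.
      exact: (congr1 (fun h : psh_hom (grids (alg_ob M)) (alg_ob M) => h n t)
        (alg_str_eval M)).
    by split; apply: psh_hom_ext => n t; rewrite /= grid_map_id E.
  pose to M : alg_hom (alg_of_omega_ob (alg_omega M)) M :=
    exist _ (psh_id (alg_ob M)) (idP M).1.
  have to_nat (M N : alg_cat grids_monad) (f : hom M N) :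
      @cmp (alg_cat grids_monad) _ _ _ (to N)
        (fmap (functor_comp alg_of_omega omega_of_alg) f) =
      @cmp (alg_cat grids_monad) _ _ _ f (to M).
    by apply: sval_inj_prop; apply: psh_hom_ext.
  exists (@NatTrans _ _ (functor_comp alg_of_omega omega_of_alg)
    (functor_id (alg_cat grids_monad)) to to_nat) => M.
  exists (exist _ (psh_id (alg_ob M)) (idP M).2).
  by split; apply: sval_inj_prop; apply: psh_hom_ext.
Qed.

Theorem proposition3p20 :
  exists T : monad (Psh semicube),
    is_familial_monad T /\
    exists K : functor omega_cat (alg_cat T),
      is_equivalence K /\
      nat_isomorphic (functor_comp (alg_forget T) K) omega_forget.
Proof.
exists grids_monad; split.
  by split; [exact: grids_familial|exact: grids_unit_cartesian
            |exact: grids_mult_cartesian].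
exists alg_of_omega; split; first exact: alg_of_omega_equivalence.
have to_nat (A B : omega_cat) (f : hom A B) :
    @cmp (Psh semicube) _ _ _ (psh_id B)
      (fmap (functor_comp (alg_forget grids_monad) alg_of_omega) f) =
    @cmp (Psh semicube) _ _ _ (fmap omega_forget f) (psh_id A).
  exact: psh_hom_ext.
exists (@NatTrans _ _ (functor_comp (alg_forget grids_monad) alg_of_omega)
  omega_forget (fun A => psh_id A) to_nat) => A.
by exists (psh_id A); split; apply: psh_hom_ext.
Qed.
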